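(* Let $X$ be a compact metric space, $c:X\times X\to\mathbb{R}$ continuous, and let $\alpha:X\to[0,1)$ be a continuous function such that $\int_X\alpha(x)\,d\pi_{1*}\mu(x)>0$ for every Mather measure $\mu\in\widehat{\mathcal{P}}_0$. For $\lambda\in(0,1)$ let $u_\lambda^\alpha:X\to\mathbb{R}$ be the unique function satisfying $u_\lambda^\alpha=T^-\big((1-\lambda\alpha)u_\lambda^\alpha\big)+c[0]$. Then the family $(u_\lambda^\alpha)_{\lambda\in(0,1)}$ converges uniformly as $\lambda\to0$. Moreover, denoting by $u_0^\alpha$ the limit, the two following formulas hold: (1) for every $x_0\in X$, $u_0^\alpha(x_0)=\max_{u\in\mathcal{F}_\alpha}u(x_0)$; (2) for every $x_0\in X$, $$u_0^\alpha(x_0)=\min_{\mu\in\widehat{\mathcal{P}}_0}\frac{\int_X\alpha(x)h(x,x_0)\,d\pi_{1*}\mu(x)}{\int_X\alpha(x)\,d\pi_{1*}\mu(x)}.$$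
   Context: $\pi_1,\pi_2:X\times X\to X$ are the two projections. The Lax--Oleinik operator is $T^-f(x)=\inf_{y\in X}\big(f(y)+c(y,x)\big)$. The critical constant $c[0]$ is the unique real number such that $u=T^-u+c[0]$ has a solution $u:X\to\mathbb{R}$. A critical subsolution is a function $u:X\to\mathbb{R}$ with $u(y)-u(x)\le c(x,y)+c[0]$ for all $x,y\in X$. A Borel probability measure $\mu$ on $X\times X$ is closed if $\pi_{1*}\mu=\pi_{2*}\mu$. One has $-c[0]=\min\int_{X\times X}c\,d\mu$ over closed probability measures; $\widehat{\mathcal{P}}_0$ denotes the set of closed probability measures $\mu$ with $\int c\,d\mu=-c[0]$, called Mather measures. $\mathcal{F}_\alpha$ is the set of continuous critical subsolutions $u:X\to\mathbb{R}$ such that $\int_X\alpha(x)u(x)\,d\pi_{1*}\mu(x)\le0$ for every $\mu\in\widehat{\mathcal{P}}_0$. The Peierls barrier is $h(x,y)=\liminf_{n\to+\infty}\big(c_n(x,y)+n\,c[0]\big)$, where $c_n(x,y)=\inf\sum_{i=0}^{n-1}c(x_i,x_{i+1})$ over all $(x_0,\dots,x_n)\in X^{n+1}$ with $x_0=x$, $x_n=y$. For each $\lambda\in(0,1)$, existence and uniqueness of $u^\alpha_\lambda$ hold under the stated hypotheses on $\alpha$. *)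

(* Defs.v *)
From HB Require Import structures.
From mathcomp Require Import all_boot all_order all_algebra.
From mathcomp Require Import all_classical all_reals all_analysis.

Set Implicit Arguments.
Unset Strict Implicit.
Unset Printing Implicit Defensive.

Import Order.TTheory GRing.Theory Num.Theory.
Import numFieldNormedType.Exports.

Local Open Scope classical_set_scope.
Local Open Scope ring_scope.

(* Measurable types are pointed in the library, while metricType is not; the
   base point only expresses that the space is nonempty. *)
#[short(type="pmetricType")]
HB.structure Definition PointedMetric (R : numDomainType) :=
  {T of Metric R T & Pointed T}.

Notation borel T := (g_sigma_algebraType (@open T)).

Section Definitions.
Context {R : realType} {X : pmetricType R}.
Local Open Scope ereal_scope.

Definition marginal1 (mu : set (borel (X * X)%type) -> \bar R) :
    set (borel X) -> \bar R :=
  pushforward mu (fst : borel (X * X)%type -> borel X).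

Definition marginal2 (mu : set (borel (X * X)%type) -> \bar R) :
    set (borel X) -> \bar R :=
  pushforward mu (snd : borel (X * X)%type -> borel X).

(* The infimum is taken in \bar R, so that it is -oo, and not a default real
   number, when f is unbounded below. *)
Definition lax_oleinik (c : X * X -> R) (f : X -> R) (x : X) : \bar R :=
  ereal_inf [set (f y + c (y, x))%:E | y in [set: X]].

(* On a compact space with c continuous, exactly one c0 has this property. *)
Definition is_critical_constant (c : X * X -> R) (c0 : R) : Prop :=
  exists u : X -> R, forall x, (u x)%:E = lax_oleinik c u x + c0%:E.

Definition critical_subsolution (c : X * X -> R) (c0 : R) (u : X -> R) : Prop :=
  forall x y, (u y - u x <= c (x, y) + c0)%R.

(* mu is a function on all subsets of X * X, hence the restriction to Borel A. *)
Definition closed_measure (mu : probability (borel (X * X)%type) R) : Prop :=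
  forall A : set (borel X), measurable A -> marginal1 mu A = marginal2 mu A.

Definition mather_measures (c : X * X -> R) (c0 : R) :
    set (probability (borel (X * X)%type) R) :=
  [set mu | closed_measure mu /\ \int[mu]_z (c z)%:E = (- c0)%:E].

Definition subsolutions_alpha (c : X * X -> R) (c0 : R) (alpha : X -> R) :
    set (X -> R) :=
  [set u | [/\ continuous u, critical_subsolution c c0 u &
    forall mu, mather_measures c c0 mu ->
      \int[marginal1 mu]_x (alpha x * u x)%:E <= 0]].

(* A chain (x_0, ..., x_n) is encoded by the first n + 1 terms of a sequence. *)
Definition chain_cost (c : X * X -> R) (n : nat) (x y : X) : \bar R :=
  ereal_inf [set (\sum_(i < n) c (p i, p i.+1))%:E |
    p in [set p : nat -> X | p 0%N = x /\ p n = y]].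

(* Finite-valued for the critical c0 on a compact space with c continuous. *)
Definition peierls_barrier (c : X * X -> R) (c0 : R) (x y : X) : \bar R :=
  limn_einf (fun n => chain_cost c n x y + (n%:R * c0)%:E).

Definition discounted_solution (c : X * X -> R) (c0 : R) (alpha : X -> R)
    (l : R) (u : X -> R) : Prop :=
  forall x, (u x)%:E =
    lax_oleinik c (fun y => (1 - l * alpha y) * u y)%R x + c0%:E.

End Definitions.

Definition is_max d (T : porderType d) (A : set T) (m : T) : Prop :=
  A m /\ ubound A m.

Definition is_min d (T : porderType d) (A : set T) (m : T) : Prop :=
  A m /\ lbound A m.

(* Main.v *)
Require Import Defs.
From HB Require Import structures.
From mathcomp Require Import all_boot all_order all_algebra.
From mathcomp Require Import all_classical all_reals all_analysis.
From mathcomp Require Import measurable_realfun.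
From mathcomp Require Import ring lra.

Set Implicit Arguments.
Unset Strict Implicit.
Unset Printing Implicit Defensive.

Import Order.TTheory GRing.Theory Num.Theory.
Import numFieldNormedType.Exports.

Local Open Scope classical_set_scope.
Local Open Scope ring_scope.

(** Convergence is tested along ultrafilters finer than the filter of positive
    numbers tending to 0. Along each of them the bounded functions [u l]
    converge to some function [ulim], and it is enough to show that [ulim]
    does not depend on the ultrafilter; equicontinuity, inherited from the
    uniform continuity of the cost, makes the convergence uniform.

    The limit is identified by squeezing it with the barrier formula. On
    the one hand, [ulim] belongs to [subsolutions_alpha]: integrating the
    discounted equation against a Mather measure leaves [l] times the
    integral of [alpha * u l], which is therefore nonpositive
    ([discounted_mather_le0]). Any function [v] of this class satisfies
    [v x0 <= v x + h(x, x0)], and integrating against [alpha] bounds [v x0]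
    by the barrier quotient of every Mather measure
    ([alpha_subsolution_le]). On the other hand, follow a backward
    calibrated chain x0 = p 0, p 1, ... of [u l] and let [disc k] be the
    product of the [1 - l * alpha (p j)], for j = 1 .. k. Summation by parts
    writes [u l x0], up to a small remainder, as the average with weights
    [l * disc k * alpha (p k.+1)] of the costs of the segments from [p k.+1]
    to [x0], and long segments cost about [h(p k.+1, x0)] at least. As [l]
    tends to 0 the occupation measures of these chains, weighted by
    [disc k], converge to a Mather measure, whose barrier quotient is thus
    at most [ulim x0] ([selected_measure]). So [ulim x0] is the minimum of
    the quotients, and the maximum over [subsolutions_alpha] follows from
    the same two bounds.

    Since [alpha] may vanish, two facts that are immediate for a positive
    discount need an argument: the weights [disc k] tend to 0, and the [u l]
    are uniformly bounded. Both follow from [alpha_sum_unbounded]: on a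
    chain of bounded cost [alpha] has an infinite sum, for otherwise the
    empirical measures would produce a Mather measure that does not charge
    [alpha].

    The Mather measures that have to be constructed all come from one
    compactness statement, [occupation_mather]. A limit along an ultrafilter
    of discrete probability measures is a finitely additive mean on bounded
    functions, and [mean_representation] turns it into a Borel measure: the
    compact metric space is a continuous image of the Cantor space, where a
    finitely additive content on cylinders is countably additive by
    compactness and extends by Caratheodory's theorem. Closedness of the
    limit is checked on continuous functions, which determine Borel
    probability measures ([probability_eq_continuous]). *)

(** * Finitely additive means on bounded functions *)

Definition bdd {T : Type} {R : realType} (f : T -> R) : Prop :=
  exists M, forall x, `|f x| <= M.

Section Bounded.
Context {T : Type} {R : realType}.
Implicit Types f g : T -> R.

Lemma bddD a f g : bdd f -> bdd g -> bdd (fun x => a * f x + g x).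
Proof.
move=> [M fM] [N gN]; exists (`|a| * M + N) => x.
by rewrite (le_trans (ler_normD _ _))// lerD// normrM ler_wpM2l.
Qed.

Lemma bdd_cst (a : R) : bdd (fun _ : T => a).
Proof. by exists `|a|. Qed.

Lemma bdd_indic (A : set T) : bdd (\1_A : T -> R).
Proof. by exists 1 => x; rewrite indicE ger0_norm; case: (x \in A). Qed.

Lemma bddM f g : bdd f -> bdd g -> bdd (fun x => f x * g x).
Proof.
move=> [M fM] [N gN]; exists (M * N) => x.
by rewrite normrM ler_pM.
Qed.

Lemma bdd_comp S (f : T -> R) (s : S -> T) : bdd f -> bdd (f \o s).
Proof. by move=> [M fM]; exists M => x /=. Qed.

End Bounded.

(** A finitely additive probability on all subsets of [T], seen as a functional
    on functions.  Limits along an ultrafilter produce such objects for free,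
    without any measurability; this is why they come before measures here. *)
Definition is_mean {T : Type} {R : realType} (L : (T -> R) -> R) :=
  [/\ L (fun=> 1) = 1,
      forall f, bdd f -> (forall x, 0 <= f x) -> 0 <= L f &
      forall a f g, bdd f -> bdd g ->
        L (fun x => a * f x + g x) = a * L f + L g].

Section Mean.
Context {T : Type} {R : realType} (L : (T -> R) -> R).
Hypothesis mL : is_mean L.

Lemma mean_cst a : L (fun=> a) = a.
Proof.
have [L1 _ Llin] := mL.
have L0 : L (fun=> 0) = 0.
  have := Llin 1 (fun=> 0) (fun=> 0) (bdd_cst _) (bdd_cst _).
  have -> : (fun _ : T => 1 * 0 + 0 : R) = (fun=> 0).
    by apply/funext => x; rewrite mul1r addr0.
  by rewrite mul1r => /eqP; rewrite -subr_eq0 opprD addNKr oppr_eq0 => /eqP.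
have := Llin a (fun=> 1) (fun=> 0) (bdd_cst _) (bdd_cst _).
by under eq_fun do rewrite mulr1 addr0; rewrite L0 L1 mulr1 addr0.
Qed.

Lemma meanD f g : bdd f -> bdd g -> L (fun x => f x + g x) = L f + L g.
Proof.
move=> bf bg; have [_ _ /(_ 1 f g bf bg)] := mL.
by under eq_fun do rewrite mul1r; rewrite mul1r.
Qed.

Lemma le_mean f g : bdd f -> bdd g -> (forall x, f x <= g x) -> L f <= L g.
Proof.
move=> bf bg fg; have [_ Lpos Llin] := mL.
rewrite -subr_ge0 addrC -mulN1r -Llin//; apply: Lpos; first exact: bddD.
by move=> x; rewrite mulN1r addrC subr_ge0.
Qed.

End Mean.

Lemma mean_comp {S T : Type} {R : realType} (L : (S -> R) -> R) (s : S -> T) :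
  is_mean L -> is_mean (fun f => L (f \o s)).
Proof.
move=> [L1 Lpos Llin]; split => //.
- by move=> f bf f0; apply: Lpos => [|x /=]; [exact: bdd_comp|].
- by move=> a f g bf bg; rewrite -Llin//; exact: bdd_comp.
Qed.

Section ProbabilityMean.
Context d (T : measurableType d) (R : realType) (P : probability T R).
Implicit Types f g : T -> R.

Lemma bdd_integrable f : measurable_fun setT f -> bdd f ->
  P.-integrable setT (EFin \o f).
Proof.
move=> mf [M fM]; apply: measurable_bounded_integrable => //.
  by rewrite (le_lt_trans (probability_le1 P _))// ltry.
exists M; split; first exact: num_real.
by move=> x Mx t _; exact: le_trans (fM t) (ltW Mx).
Qed.

Lemma bdd_EFin_Rintegral f : measurable_fun setT f -> bdd f ->
  (\int[P]_x (f x)%:E)%E = (\int[P]_x f x)%:E.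
Proof.
by move=> mf bf; rewrite fineK//;
  exact: integrable_fin_num (bdd_integrable mf bf).
Qed.

Lemma Rintegral_linear a f g : measurable_fun setT f -> bdd f ->
  measurable_fun setT g -> bdd g ->
  \int[P]_x (a * f x + g x) = a * \int[P]_x f x + \int[P]_x g x.
Proof.
move=> mf bf mg bg.
have baf : bdd (fun x => a * f x) by apply: bddM => //; exact: bdd_cst.
have maf : measurable_fun setT (fun x => a * f x) by exact: measurable_funM.
rewrite RintegralD//; [|exact: bdd_integrable|exact: bdd_integrable].
by rewrite RintegralZl//; exact: bdd_integrable.
Qed.

Lemma Rintegral_cst_prob a : \int[P]_x a = a.
Proof.
by rewrite Rintegral_cst// [X in fine X](probability_setT P) mulr1.
Qed.

Lemma le_Rintegral_bdd f g : measurable_fun setT f -> bdd f ->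
  measurable_fun setT g -> bdd g -> (forall x, f x <= g x) ->
  \int[P]_x f x <= \int[P]_x g x.
Proof.
by move=> mf bf mg bg fg; apply: le_Rintegral => //; exact: bdd_integrable.
Qed.

End ProbabilityMean.

(** * Cylinders of the Cantor space *)

Definition agree (n : nat) (x y : cantor_space) : Prop :=
  forall i, (i < n)%N -> x i = y i.

Lemma agreeS n m x y : (n <= m)%N -> agree m x y -> agree n x y.
Proof. by move=> nm xy i ni; apply: xy; exact: leq_trans nm. Qed.

Lemma near_agree n (x : cantor_space) : nbhs x (agree n x).
Proof.
elim: n => [|n IH]; first by apply: (@filterE _ (nbhs x)) => y i.
have xn : nbhs x [set y : cantor_space | y n = x n].
  apply: (@proj_continuous nat (fun=> bool) n x [set x n]) => /=.
  exact: discrete_set1.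
apply: (@filterS2 _ (nbhs x) _ _ _ _ _ IH xn) => y xy yxn i.
by rewrite ltnS leq_eqVlt => /predU1P[->|/xy].
Qed.

(** The cylinders around [x] form a filter whose only cluster point is [x],
    because two distinct sequences differ at some coordinate; in a compact
    Hausdorff space such a filter converges to [x]. *)
Lemma nbhs_agree (x : cantor_space) (U : set cantor_space) :
  nbhs x U -> exists n, forall y, agree n x y -> U y.
Proof.
pose G : set_system cantor_space := filter_from [set: nat] (fun n => agree n x).
have PG : ProperFilter G.
  apply: filter_from_proper => [|n _]; last by exists x.
  apply: filter_from_filter; first by exists 0%N.
  move=> m n _ _; exists (maxn m n) => // y xy.
  by split; apply: agreeS xy; rewrite ?leq_maxl ?leq_maxr.
move=> xU; suff : G --> x by move=> /(_ U xU)[n _ nU]; exists n => y /nU.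
apply: (compact_cluster_set1 cantor_space_hausdorff cantor_space_compact) => //.
- exact: filterT.
- exact: filterT.
apply/seteqP; split => [y /= yG|_ ->].
  apply/funext => i; apply/esym.
  have Gx : G (agree i.+1 x) by exists i.+1.
  have [z [xz yz]] := yG _ _ Gx (near_agree i.+1 y).
  by rewrite xz// yz.
by move=> A B [n _ nA] /nbhs_singleton Bx; exists x; split => //; exact: nA.
Qed.

(** Sets decided by finitely many coordinates; the number of coordinates is
    not fixed, so these sets form an algebra. *)
Definition cylinder (A : set cantor_space) : Prop :=
  exists n, forall x y, agree n x y -> A x -> A y.

Lemma agree_sym n x y : agree n x y -> agree n y x.
Proof. by move=> xy i ni; rewrite xy. Qed.

Lemma cylinder0 : cylinder set0. Proof. by exists 0%N. Qed.

Lemma cylinderC : setC_closed cylinder.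
Proof.
by move=> A [n nA]; exists n => x y xy Ax Ay; exact/Ax/nA/Ay/agree_sym.
Qed.

Lemma cylinderU : setU_closed cylinder.
Proof.
move=> A B [n nA] [m mB]; exists (maxn n m) => x y xy [Ax|Bx].
  by left; apply: nA Ax; apply: agreeS xy; rewrite leq_maxl.
by right; apply: mB Bx; apply: agreeS xy; rewrite leq_maxr.
Qed.

Lemma near_cylinder (A : set cantor_space) x : cylinder A ->
  \forall y \near x, A y <-> A x.
Proof.
move=> [n nA]; apply: (@filterS _ (nbhs x) _ _ _ _ (near_agree n x)) => y xy.
by split; apply: nA; [exact: agree_sym|].
Qed.

(** A separate name for the Cantor space, to carry the algebra of cylinders as
    its measurable structure. *)
Definition cantor_algebra : Type := cantor_space.
HB.instance Definition _ := Pointed.on cantor_algebra.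
HB.instance Definition _ := isAlgebraOfSets.Build default_measure_display
  cantor_algebra cylinder0 cylinderU cylinderC.

(** Cylinders are clopen and the space is compact, so a countable union of
    cylinders that is a cylinder is a finite union.  Hence every finitely
    additive content on cylinders is automatically countably additive. *)
Lemma cylinder_bigcup_finite (F : (set cantor_space)^nat) :
  (forall i, cylinder (F i)) -> cylinder (\bigcup_i F i) ->
  \forall n \near \oo, \bigcup_i F i = \big[setU/set0]_(i < n) F i.
Proof.
move=> cF cUF.
have /compact_near_coveringP := cantor_space_compact.
move=> /(_ _ \oo (fun n x =>
  (\bigcup_i F i) x -> (\big[setU/set0]_(i < n) F i) x)).
move=> /(_ _); have H : forall x, [set: cantor_space] x ->
    \forall x' \near x & n \near \oo,
      (\bigcup_i F i) x' -> (\big[setU/set0]_(i < n) F i) x'.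
  move=> x _; have [[i _ Fix]|nFx] := pselect ((\bigcup_i F i) x).
    near=> y n => _; rewrite -bigcup_mkord; exists i => /=.
      by near: n; exact: nbhs_infty_gt.
    suff : F i y <-> F i x by move=> ->.
    by near: y; exact: near_cylinder.
  near=> y n.
  suff /[swap] : (\bigcup_i F i) y <-> (\bigcup_i F i) x by move=> Uy [/(_ Uy)].
  by near: y; exact: near_cylinder.
move=> /(_ H) {}H; near=> n; apply/seteqP; split => [x|].
  by move: x (I : [set: cantor_space] x); near: n; exact: H.
by rewrite -bigcup_mkord => x [i _ Fix]; exists i.
Unshelve. all: by end_near. Qed.

(** * From means to measures on the Cantor space *)

Section CylinderMeasure.
Context {R : realType} (L : (cantor_space -> R) -> R).
Hypothesis mL : is_mean L.

Definition cylinder_content (A : set cantor_algebra) : \bar R := (L \1_A)%:E.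

Local Notation m := cylinder_content.

Lemma cylinder_content0 : m set0 = 0%E.
Proof. by rewrite /m indic0 (mean_cst mL). Qed.

Lemma cylinder_content_ge0 A : (0 <= m A)%E.
Proof.
have [_ Lpos _] := mL.
by rewrite lee_fin; apply: Lpos => [|x]; [exact: bdd_indic|rewrite indicE].
Qed.

Lemma cylinder_contentU A B : A `&` B = set0 -> m (A `|` B) = (m A + m B)%E.
Proof.
move=> AB0; rewrite /m -EFinD -(meanD mL); try exact: bdd_indic.
congr (L _)%:E; apply/funext => x; rewrite !indicE in_setU.
have : (x \in A) && (x \in B) = false by rewrite -in_setI AB0 in_set0.
by case: (x \in A); case: (x \in B) => //=; rewrite ?addr0 ?add0r.
Qed.

Lemma cylinder_content_sigma_additive : semi_sigma_additive m.
Proof.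
move=> F cF tF cUF.
have finF n : (\sum_(0 <= i < n) m (F i) = m (\big[setU/set0]_(i < n) F i))%E.
  elim: n => [|n IH]; first by rewrite big_geq// big_ord0 cylinder_content0.
  rewrite big_nat_recr//= IH big_ord_recr/= cylinder_contentU//.
  rewrite -bigcup_mkord setI_bigcupl; apply/bigcup0P => i /= ni.
  by move/trivIsetP : tF; apply=> //; rewrite lt_eqF.
apply: cvg_near_cst.
apply: filterS (cylinder_bigcup_finite cF cUF) => n.
by rewrite finF => ->.
Qed.

HB.instance Definition _ := isMeasure.Build _ _ _ cylinder_content
  cylinder_content0 cylinder_content_ge0 cylinder_content_sigma_additive.

Definition cantor_measurable : measurableType _ :=
  g_sigma_algebraType (@measurable _ cantor_algebra).

Definition cantor_measure : set cantor_measurable -> \bar R :=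
  measure_extension m.
HB.instance Definition _ := Measure.on cantor_measure.

Lemma cantor_measureE (A : set cantor_space) :
  cylinder A -> cantor_measure A = (L \1_A)%:E.
Proof.
by move=> cA; rewrite /cantor_measure /measure_extension measurable_mu_extE.
Qed.

Lemma cantor_measure_setT : cantor_measure setT = 1%E.
Proof.
have [L1 _ _] := mL.
rewrite cantor_measureE; last by exists 0%N.
by rewrite indicT; congr EFin.
Qed.

HB.instance Definition _ :=
  Measure_isProbability.Build _ _ _ cantor_measure cantor_measure_setT.

End CylinderMeasure.

(** Cylinders generate the Borel sets: [U] is the countable union, over [n], of
    the points whose whole cylinder of length [n] lies in [U]. *)
Lemma cantor_open_measurable (U : set cantor_space) :
  open U -> measurable (U : set cantor_measurable).
Proof.
move=> oU.
have -> : U = \bigcup_n [set x | forall y, agree n x y -> U y].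
  apply/seteqP; split => [x Ux|x [n _]]; last by apply.
  by have [n nU] := nbhs_agree (open_nbhs_nbhs (conj oU Ux)); exists n.
apply: bigcupT_measurable => n; apply: sub_sigma_algebra.
exists n => x y xy /= xU z yz; apply: xU => i ni; by rewrite xy// yz.
Qed.

Lemma cantor_continuous_measurable (R : realType) (f : cantor_space -> R) :
  continuous f -> measurable_fun [set: cantor_measurable] f.
Proof.
move=> /continuousP cf; apply: (measurability _ (RGenOpens.measurableE R)).
move=> _ [_ [a [b ->]] <-]; rewrite setTI; apply: cantor_open_measurable.
by apply: cf; exact: interval_open.
Qed.

(** * Riesz representation of means on compact metric spaces *)

Lemma compact_continuous_bdd (T : topologicalType) (R : realType) (f : T -> R) :
  compact [set: T] -> continuous f -> bdd f.
Proof.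
move=> cT cf.
have : compact (range f).
  by apply: continuous_compact => //; exact: continuous_subspaceT.
move=> /compact_bounded[M [_ /(_ (M + 1))]].
rewrite ltrDl ltr01 => /(_ isT) fM.
by exists (M + 1) => x; apply: fM; exists x.
Qed.

Lemma cantor_uniform_continuity (R : realType) (f : cantor_space -> R) (e : R) :
  continuous f -> 0 < e ->
  exists n, forall x y, agree n x y -> `|f x - f y| < e.
Proof.
move=> cf e0.
have /compact_near_coveringP := cantor_space_compact.
move=> /(_ _ \oo (fun n x => forall y, agree n x y -> `|f x - f y| < e)).
move=> /(_ _)[].
  move=> x _.
  have : \forall y \near x, `|f x - f y| < e / 2.
    by move/cvgrPdist_lt : (cf x); apply; rewrite divr_gt0.
  move=> /nbhs_agree[n nf]; near=> y m => z /= yz.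
  have xy : agree n x y by near: y; exact: near_agree.
  have xz : agree n x z.
    move=> i ni; rewrite xy// yz//; apply: leq_trans ni _.
    by near: m; exact: nbhs_infty_ge.
  rewrite -(subrKA (f x)) (le_lt_trans (ler_normD _ _))// [ltRHS]splitr.
  by rewrite ltrD ?nf// distrC nf.
by move=> N _ NP; exists N => x; apply: NP => //=.
Unshelve. all: by end_near. Qed.

Section CantorRiesz.
Context {R : realType} (L : (cantor_space -> R) -> R).
Hypothesis mL : is_mean L.
Local Notation P := (cantor_measure mL).

Let good (f : cantor_measurable -> R) : Prop :=
  [/\ bdd f, measurable_fun setT f & \int[P]_x f x = L f].

Let good_linear a f g : good f -> good g -> good (fun x => a * f x + g x).
Proof.
have [_ _ Llin] := mL.
move=> [bf mf Pf] [bg mg Pg]; split; first exact: bddD.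
  by apply: measurable_funD => //; exact: measurable_funM.
by rewrite Rintegral_linear// Pf Pg Llin.
Qed.

Let good_indic A : cylinder A -> good \1_A.
Proof.
move=> cA; have mA : measurable (A : set cantor_measurable).
  exact: sub_sigma_algebra.
split; [exact: bdd_indic|exact: measurable_indic|].
rewrite /Rintegral integral_indic// setIT -[RHS]/(fine (L \1_A)%:E).
by congr fine; exact: cantor_measureE.
Qed.

Let good_sum (I : Type) (s : seq I) (c : I -> R) (A : I -> set cantor_space) :
  (forall i, cylinder (A i)) ->
  good (fun x => \sum_(i <- s) c i * \1_(A i) x).
Proof.
move=> cA; elim: s => [|i s IH].
  have -> : (fun x : cantor_measurable => \sum_(i <- [::]) c i * \1_(A i) x) =
      (fun=> 0) by apply/funext => x; rewrite big_nil.
  by split; [exact: bdd_cst|exact: measurable_cst|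
    rewrite Rintegral_cst_prob (mean_cst mL)].
under [X in good X]eq_fun do rewrite big_cons.
by apply: good_linear => //; exact: good_indic.
Qed.

Let word_cylinder n (w : n.-tuple bool) : set cantor_space :=
  [set x | forall i : 'I_n, x i = tnth w i].

Let word_cylinderP n (w : n.-tuple bool) : cylinder (word_cylinder w).
Proof. by exists n => x y xy wx i; rewrite -xy. Qed.

(** The integral and the mean agree on indicators of cylinders, hence on step
    functions over cylinders, and these approximate [f] uniformly. *)
Lemma cantor_measure_continuous (f : cantor_space -> R) :
  continuous f -> \int[P]_x f x = L f.
Proof.
move=> cf; have bf := compact_continuous_bdd cantor_space_compact cf.
have mf := cantor_continuous_measurable cf.
apply/eqP; rewrite -subr_eq0 -normr_le0.
apply/ler_addgt0Pr => e e0; rewrite add0r.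
have e20 : 0 < e / 2 by rewrite divr_gt0.
have [n nf] := cantor_uniform_continuity cf e20.
pose pad (w : n.-tuple bool) : cantor_space := nth false w.
(* The step function freezing f at one sample point of each word cylinder *)
pose g x :=
  \sum_(w <- enum {: n.-tuple bool}) f (pad w) * \1_(word_cylinder w) x.
have gE x : g x = f (pad [tuple x i | i < n]).
  rewrite /g (bigD1_seq [tuple x i | i < n])/= ?mem_enum ?enum_uniq//.
  rewrite big1 ?addr0 ?indicE ?mem_set ?mulr1// => [i|w wx].
    by rewrite tnth_mktuple.
  rewrite indicE memNset ?mulr0// => xw; move/eqP: wx; apply.
  by apply: eq_from_tnth => i; rewrite tnth_mktuple xw.
have [bg mg Pg] : good g by apply: good_sum => w; exact: word_cylinderP.
have fg x : `|f x - g x| < e / 2.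
  rewrite gE; apply: nf => i ni.
  by rewrite /pad -(tnth_nth false _ (Ordinal ni)) tnth_mktuple.
have bc a (h : cantor_measurable -> R) : bdd h -> bdd (fun x => h x + a).
  by move=> bh; have := bddD 1 bh (bdd_cst a); under eq_fun do rewrite mul1r.
have mc a (h : cantor_measurable -> R) : measurable_fun setT h ->
    measurable_fun setT (fun x => h x + a).
  by move=> mh; apply: measurable_funD.
have Pc a : \int[P]_x (g x + a) = L g + a.
  rewrite -[in RHS]Pg -[in RHS](mul1r (\int[P]_x g x)).
  rewrite -[in RHS](Rintegral_cst_prob P a) -Rintegral_linear//;
    last exact: bdd_cst.
  by under [in RHS]eq_Rintegral do rewrite mul1r.
have Lc a : L (fun x => g x + a) = L g + a.
  by rewrite (meanD mL)// ?(mean_cst mL)//; exact: bdd_cst.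
have H1 : \int[P]_x f x <= L g + e / 2.
  rewrite -Pc; apply: le_Rintegral_bdd => //; [exact: mc|exact: bc|].
  by move=> x; have := fg x; rewrite ltr_distl => /andP[_ /ltW].
have H2 : L g - e / 2 <= \int[P]_x f x.
  rewrite -Pc; apply: le_Rintegral_bdd => //; [exact: mc|exact: bc|].
  by move=> x; have := fg x; rewrite ltr_distl => /andP[/ltW].
have H3 : L f <= L g + e / 2.
  rewrite -Lc; apply: (le_mean mL) => //; first exact: bc.
  by move=> x; have := fg x; rewrite ltr_distl => /andP[_ /ltW].
have H4 : L g - e / 2 <= L f.
  rewrite -Lc; apply: (le_mean mL) => //; first exact: bc.
  by move=> x; have := fg x; rewrite ltr_distl => /andP[/ltW].
rewrite ler_distl; move: (L f) (L g) (\int[P]_x f x) H1 H2 H3 H4 => a b i.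
by clear=> H1 H2 H3 H4; apply/andP; split; lra.
Qed.

End CantorRiesz.

Section Borel.
Context {R : realType}.

Lemma borel_open (T : ptopologicalType) (U : set T) :
  open U -> measurable (U : set (borel T)).
Proof. exact: sub_sigma_algebra. Qed.

Lemma continuous_borel (T : ptopologicalType) (f : T -> R) :
  continuous f -> measurable_fun [set: borel T] f.
Proof.
move=> /continuousP cf; apply: (measurability _ (RGenOpens.measurableE R)).
move=> _ [_ [a [b ->]] <-]; rewrite setTI; apply: borel_open.
by apply: cf; exact: interval_open.
Qed.

Lemma continuous_borel_map (S T : ptopologicalType) (f : S -> T) :
  continuous f -> measurable_fun [set: borel S] (f : borel S -> borel T).
Proof.
move=> /continuousP cf.
apply: (@measurability _ _ (borel S) (borel T) _ _ (@open T)) => //.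
by move=> _ [U oU <-]; rewrite setTI; apply: borel_open; exact: cf.
Qed.

End Borel.

(** By the Alexandroff-Hausdorff theorem [K] is a continuous image of the Cantor
    space.  The mean is pulled back along an arbitrary (in general
    discontinuous) section of that surjection, represented there by a measure,
    and pushed forward; the section cancels on functions of the form
    [f \o g]. *)
Lemma mean_representation (R : realType) (K : pseudoPMetricType R)
    (L : (K -> R) -> R) :
  compact [set: K] -> hausdorff_space K -> is_mean L ->
  exists mu : probability (borel K) R,
    forall f : K -> R, continuous f -> \int[mu]_x f x = L f.
Proof.
move=> cK hK mL.
have [g cg] := cantor_surj cK hK.
have [s gs] : {s : K -> cantor_space & forall x, g (s x) = x}.
  apply: (@choice _ _ (fun x y => g y = x)) => x.
  by have [y _ <-] := @surj _ _ _ _ g x I; exists y.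
have mL' := mean_comp s mL.
have mg : measurable_fun [set: cantor_measurable] (g : _ -> borel K).
  apply: (@measurability _ _ cantor_measurable (borel K) _ _ (@open K)) => //.
  move=> _ [U oU <-]; rewrite setTI; apply: cantor_open_measurable.
  by move/continuousP : cg; exact.
pose gm : {mfun cantor_measurable >-> borel K} :=
  HB.pack (g : cantor_measurable -> borel K)
    (isMeasurableFun.Build _ _ _ _ _ mg).
exists (distribution (cantor_measure mL') gm) => f cf.
have cfg : continuous (f \o g).
  by move=> x; apply: continuous_comp; [exact: cg|exact: cf].
rewrite /Rintegral integral_distribution.
- rewrite -/(Rintegral _ _ _) [LHS](cantor_measure_continuous mL' cfg).
  by congr L; apply/funext => x /=; rewrite gs.
- apply/measurable_EFinP; exact: (continuous_borel cf).
- apply: (@bdd_integrable _ cantor_measurable _ (cantor_measure mL') (f \o g)).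
    exact: cantor_continuous_measurable.
  exact: compact_continuous_bdd cantor_space_compact cfg.
Qed.

(** * Continuous functions determine Borel probability measures *)

Lemma bounded_convergence d (T : measurableType d) (R : realType)
    (P : probability T R) (f_ : nat -> T -> R) (f : T -> R) (M : R) :
  (forall n, measurable_fun setT (f_ n)) -> measurable_fun setT f ->
  (forall n x, `|f_ n x| <= M) -> (forall x, f_ n x @[n --> \oo] --> f x) ->
  \int[P]_x f_ n x @[n --> \oo] --> \int[P]_x f x.
Proof.
move=> mf_ mf f_M f_f.
have bf : bdd f.
  exists M => x; have fx : `|f_ n x| @[n --> \oo] --> `|f x| by exact: cvg_norm.
  rewrite -(cvg_lim _ fx)//; apply: limr_le.
    by apply/cvg_ex; eexists; exact: fx.
  by apply: nearW => n; exact: f_M.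
have /= := @dominated_convergence _ T R P setT measurableT
  (fun n x => (f_ n x)%:E) (EFin \o f) (cst M%:E).
case=> //.
- by move=> n; exact/measurable_EFinP.
- exact/measurable_EFinP.
- by apply/aeW => x _; apply: cvg_EFin; [exact: nearW|exact: f_f].
- by apply: (@bdd_integrable _ _ _ _ (cst M)) => //; exact: bdd_cst.
- by apply/aeW => x n _; rewrite lee_fin.
move=> _ _; rewrite (bdd_EFin_Rintegral P mf bf) => H.
by apply: fine_cvg H.
Qed.

Section InfDist.
Context {R : realType} {X : metricType R} (A : set X).
Hypothesis A0 : A !=set0.

Definition infdist (x : X) : R := inf [set mdist x a | a in A].

Let infdist_lb x : lbound [set mdist x a | a in A] 0.
Proof. by move=> _ [a _ <-]; exact: mdist_ge0. Qed.

Lemma infdist_ge0 x : 0 <= infdist x.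
Proof. by apply: lb_le_inf; [exact: image_nonempty|exact: infdist_lb]. Qed.

Lemma infdist_eq0 x : A x -> infdist x = 0.
Proof.
move=> Ax; apply/eqP; rewrite eq_le infdist_ge0 andbT.
by apply: ge_inf; [exists 0; exact: infdist_lb|exists x => //; rewrite mdistxx].
Qed.

Lemma infdist_le x y : infdist x <= mdist x y + infdist y.
Proof.
rewrite addrC -lerBlDr; apply: lb_le_inf; first exact: image_nonempty.
move=> _ [a Aa <-]; rewrite lerBlDr addrC (le_trans _ (metric_triangle x y a))//.
by apply: ge_inf; [exists 0; exact: infdist_lb|exists a].
Qed.

Lemma infdist_continuous : continuous infdist.
Proof.
move=> x; apply/cvgrPdist_lt => e e0.
have : nbhs x (ball x e) by exact: nbhsx_ballx.
apply: filterS => y; rewrite ballEmdist/= => xy.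
have := infdist_le x y; have := infdist_le y x; rewrite (metric_sym y x) => h1 h2.
by rewrite ltr_distl; apply/andP; split; lra.
Qed.

Lemma infdist_gt0 x : closed A -> ~ A x -> 0 < infdist x.
Proof.
move=> cA nAx; have : nbhs x (~` A).
  by apply: open_nbhs_nbhs; split => //; exact: closed_openC.
move=> /nbhs_ballP[e /= e0 eA].
apply: (lt_le_trans e0); apply: lb_le_inf; first exact: image_nonempty.
move=> _ [a Aa <-]; rewrite leNgt; apply/negP => xa.
by apply: (eA a) => //; rewrite ballEmdist.
Qed.

End InfDist.

(** The indicator of an open set [U] is the bounded limit of the continuous
    functions [min(1, n d(x, ~U))], so the two measures agree on open sets,
    a pi-system generating the Borel sets. *)
Lemma probability_eq_continuous (R : realType) (X : pmetricType R)
    (P Q : probability (borel X) R) :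
  (forall f : X -> R, continuous f -> bdd f ->
    \int[P]_x f x = \int[Q]_x f x) ->
  forall A, measurable A -> P A = Q A.
Proof.
move=> PQ; suff openPQ U : open U -> P U = Q U.
  apply: (@measure_unique _ R (borel X) (@open X) (fun=> setT)) => //.
  - exact: openI.
  - by move=> _; exact: openT.
  - by apply/seteqP; split => // x _; exists 0%N.
  - by move=> _; rewrite [X in (X < _)%E](probability_setT P) ltry.
move=> oU; have [U0|/set0P A0] := eqVneq (~` U) set0.
  have -> : U = setT by rewrite -(setCK U) U0 setC0.
  by rewrite [LHS](probability_setT P) [RHS](probability_setT Q).
pose A := ~` U; have cA : closed A by exact: open_closedC.
pose phi n x := Num.min 1 (n%:R * infdist A x).
have phi_cont n : continuous (phi n).
  move=> x.
  apply: (@continuous_min _ _ (fun=> 1) (fun y => n%:R * infdist A y)).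
    exact: cst_continuous.
  by apply: continuousM; [exact: cst_continuous|exact: infdist_continuous].
have phi01 n x : `|phi n x| <= 1.
  have ? : 0 <= phi n x by rewrite le_min ler01 mulr_ge0// infdist_ge0.
  by rewrite ger0_norm// ge_min lexx.
have phi_cvg x : phi n x @[n --> \oo] --> (\1_U x : R).
  rewrite indicE; have [Ux|nUx] := pselect (U x).
    rewrite mem_set//; apply: cvg_near_cst.
    have d0 : 0 < infdist A x by apply: infdist_gt0 => //; exact: contrapT.
    near=> n; apply/eqP; rewrite eq_minl// -ler_pdivrMr// mul1r.
    by near: n; exact: nbhs_infty_ger.
  rewrite memNset//; under eq_fun do rewrite /phi infdist_eq0// mulr0.
  by rewrite min_r//; exact: cvg_cst.
have cvgI (m : probability (borel X) R) :
    \int[m]_x phi n x @[n --> \oo] --> fine (m U).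
  have -> : fine (m U) = \int[m]_x (\1_U x : R).
    by rewrite /Rintegral integral_indic ?setIT//; exact: borel_open.
  apply: (@bounded_convergence _ (borel X) R m phi \1_U 1) => //.
  - by move=> n; exact: (continuous_borel (phi_cont n)).
  - by apply: measurable_indic; exact: borel_open.
have PQU : fine (P U) = fine (Q U).
  have e : (fun n => \int[P]_x phi n x) = (fun n => \int[Q]_x phi n x).
    by apply/funext => n; apply: (PQ (phi n)); [exact: phi_cont|exists 1].
  have := cvgI P; rewrite e => cvgP.
  exact: (cvg_unique (@Rhausdorff R) cvgP (cvgI Q)).
rewrite -[LHS]fineK ?fin_num_measure//; last exact: borel_open.
by rewrite PQU fineK ?fin_num_measure//; exact: borel_open.
Unshelve. all: by end_near. Qed.

(** * Limits along ultrafilters *)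

Lemma ultra_bounded_cvg (R : realType) (I : Type) (F : set_system I)
    (f : I -> R) (M : R) : UltraFilter F ->
  (\forall i \near F, `|f i| <= M) -> cvg (f i @[i --> F]).
Proof.
move=> UF fM; have cM : compact `[- M, M] by exact: segment_compact.
have [] := cM (f i @[i --> F]) _.
  by apply: filterS fM => i; rewrite /= in_itv/= ler_norml.
move=> l [_ lF]; apply/cvg_ex; exists l => A lA.
have [//|FnA] := in_ultra_setVsetC (f @^-1` A) UF.
by have [y []] := lF (~` A) A FnA lA.
Qed.

Lemma filter_le_cvg (R : realType) (I : Type) (F : set_system I)
    (f g : I -> R) (a b : R) : ProperFilter F ->
  f i @[i --> F] --> a -> g i @[i --> F] --> b ->
  (\forall i \near F, f i <= g i) -> a <= b.
Proof.
move=> PF fa gb fg; rewrite -subr_ge0.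
have gf : g i - f i @[i --> F] --> b - a by exact: cvgB.
by apply: (cvgr_to_ge gf); apply: filterS fg => i; rewrite subr_ge0.
Qed.

Section UltraMean.
Context {T I : Type} {R : realType} (F : set_system I) {UF : UltraFilter F}.
Variable m : I -> (T -> R) -> R.
Hypothesis m_mean : \forall i \near F, is_mean (m i).

Definition ultralim (f : T -> R) : R := lim (m i f @[i --> F]).

Lemma ultralim_cvg f : bdd f -> m i f @[i --> F] --> ultralim f.
Proof.
move=> bf; have [M fM] := bf.
suff : cvg (m i f @[i --> F]) by [].
apply: (@ultra_bounded_cvg _ _ _ _ M) => //; apply: filterS m_mean => i mi.
rewrite ler_norml -(mean_cst mi (- M)) -[X in _ && (_ <= X)](mean_cst mi M).
by apply/andP; split; apply: le_mean => //; (try exact: bdd_cst) => x;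
  have := fM x; rewrite ler_norml => /andP[].
Qed.

Lemma ultralim_mean : is_mean ultralim.
Proof.
have PF : ProperFilter F by exact: ultra_proper.
split.
- have h : m i (fun=> 1) @[i --> F] --> (1 : R).
    by apply: cvg_near_cst; apply: filterS m_mean => i [].
  have h2 := ultralim_cvg (bdd_cst (1 : R)).
  exact: (cvg_unique (@Rhausdorff R) h2 h).
- move=> f bf f0; have fF := ultralim_cvg bf.
  have f0F : \forall i \near F, 0 <= m i f.
    by apply: filterS m_mean => i [_ mpos _]; exact: mpos.
  exact: (cvgr_to_ge fF f0F).
- move=> a f g bf bg.
  have h : m i (fun x => a * f x + g x) @[i --> F] -->
      a * ultralim f + ultralim g.
    have H : a * m i f + m i g @[i --> F] --> a * ultralim f + ultralim g.
      apply: cvgD; last exact: ultralim_cvg.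
      by apply: cvgM; [exact: cvg_cst|exact: ultralim_cvg].
    apply: cvg_trans H; apply: near_eq_cvg.
    by apply: filterS m_mean => i [_ _ ->].
  exact: (cvg_unique (@Rhausdorff R) (ultralim_cvg (bddD a bf bg)) h).
Qed.

End UltraMean.

(** Summation by parts with weights decreasing from [w 0]: the sum only sees
    the two ends of the sequence, whatever its length. *)
Lemma abel_bound (R : realType) (w a : nat -> R) (M : R) n :
  (forall k, 0 <= w k.+1 <= w k) -> 0 <= w 0%N -> (forall k, `|a k| <= M) ->
  `|\sum_(k < n) w k * (a k.+1 - a k)| <= 2 * M * w 0%N.
Proof.
move=> wd w0 aM.
have wge0 k : 0 <= w k by case: k => [//|k]; have /andP[] := wd k.
have H : `|\sum_(k < n) w k * (a k.+1 - a k) - w n * a n| <=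
    M * (2 * w 0%N - w n).
  elim: n => [|n IH].
    rewrite big_ord0 sub0r normrN normrM ger0_norm// mulrC.
    by rewrite mulr2n mulrDl !mul1r addrK ler_wpM2r.
  rewrite big_ord_recr/=.
  have -> : \sum_(i < n) w i * (a i.+1 - a i) + w n * (a n.+1 - a n) -
      w n.+1 * a n.+1 =
    (\sum_(i < n) w i * (a i.+1 - a i) - w n * a n) +
      (w n - w n.+1) * a n.+1 by ring.
  have /andP[_ wn] := wd n.
  rewrite (le_trans (ler_normD _ _))//.
  have -> : M * (2 * w 0%N - w n.+1) =
    M * (2 * w 0%N - w n) + (w n - w n.+1) * M by ring.
  by rewrite lerD// normrM ger0_norm ?subr_ge0// ler_wpM2l ?subr_ge0.
rewrite -(subrK (w n * a n) (\sum_(k < n) _)) (le_trans (ler_normD _ _))//.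
have -> : 2 * M * w 0%N = M * (2 * w 0%N - w n) + w n * M by ring.
by rewrite lerD// normrM ger0_norm// ler_wpM2l.
Qed.

(** * Marginals of a measure on the square *)

HB.instance Definition _ (R : realType) (T U : pseudoPMetricType R) :=
  Pointed.on (T * U)%type.

Lemma prod_hausdorff (T U : topologicalType) :
  hausdorff_space T -> hausdorff_space U -> hausdorff_space (T * U)%type.
Proof.
move=> hT hU [p1 p2] [q1 q2] pq; congr (_, _).
- apply: hT => A B Ap Bq.
  have [[x y] [/= Ax Bx]] : (fst @^-1` A `&` fst @^-1` B : set (T * U)) !=set0.
    by apply: pq; [exact: (@cvg_fst _ _ (nbhs p1) (nbhs p2))|
      exact: (@cvg_fst _ _ (nbhs q1) (nbhs q2))].
  by exists x.
- apply: hU => A B Ap Bq.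
  have [[x y] [/= Ax Bx]] : (snd @^-1` A `&` snd @^-1` B : set (T * U)) !=set0.
    by apply: pq; [exact: (@cvg_snd _ _ (nbhs p1) (nbhs p2))|
      exact: (@cvg_snd _ _ (nbhs q1) (nbhs q2))].
  by exists y.
Qed.

Section Marginals.
Context {R : realType} {X : pmetricType R}.
Hypothesis X_compact : compact [set: X].
Implicit Types (mu : probability (borel (X * X)%type) R) (f : X -> R).

Lemma fst_continuous : continuous (fst : X * X -> X).
Proof. by move=> x; exact: cvg_fst. Qed.

Lemma snd_continuous : continuous (snd : X * X -> X).
Proof. by move=> x; exact: cvg_snd. Qed.

Lemma fst_measurable :
  measurable_fun [set: borel (X * X)%type] (fst : _ -> borel X).
Proof. exact: (@continuous_borel_map (X * X)%type X fst fst_continuous). Qed.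

Lemma snd_measurable :
  measurable_fun [set: borel (X * X)%type] (snd : _ -> borel X).
Proof. exact: (@continuous_borel_map (X * X)%type X snd snd_continuous). Qed.

HB.instance Definition _ := isMeasurableFun.Build _ _ _ _
  (fst : borel (X * X)%type -> borel X) fst_measurable.
HB.instance Definition _ := isMeasurableFun.Build _ _ _ _
  (snd : borel (X * X)%type -> borel X) snd_measurable.

Let fst_mfun : {mfun borel (X * X)%type >-> borel X} := fst.
Let snd_mfun : {mfun borel (X * X)%type >-> borel X} := snd.

(** Convertible to [marginal1 mu] and [marginal2 mu], but packaged as
    probability measures so that the integration lemmas apply. *)
Definition first_marginal mu : probability (borel X) R :=
  distribution mu fst_mfun.
Definition second_marginal mu : probability (borel X) R :=
  distribution mu snd_mfun.

Lemma continuous_bdd f : continuous f -> bdd f.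
Proof. exact: compact_continuous_bdd. Qed.

Lemma square_compact : compact [set: X * X].
Proof. by rewrite -setXTT; exact: compact_setX. Qed.

Lemma square_bdd (g : X * X -> R) : continuous g -> bdd g.
Proof. exact/compact_continuous_bdd/square_compact. Qed.

Lemma comp_fst_bdd f : continuous f -> bdd (fun z : X * X => f z.1).
Proof. by move=> cf; apply: (bdd_comp fst); exact: continuous_bdd. Qed.

Lemma comp_snd_bdd f : continuous f -> bdd (fun z : X * X => f z.2).
Proof. by move=> cf; apply: (bdd_comp snd); exact: continuous_bdd. Qed.

Lemma comp_fst_measurable f : continuous f ->
  measurable_fun [set: borel (X * X)%type] (fun z : X * X => f z.1).
Proof.
by move=> cf; exact: measurableT_comp (continuous_borel cf) fst_measurable.
Qed.

Lemma comp_snd_measurable f : continuous f ->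
  measurable_fun [set: borel (X * X)%type] (fun z : X * X => f z.2).
Proof.
by move=> cf; exact: measurableT_comp (continuous_borel cf) snd_measurable.
Qed.

Lemma first_marginal_integral mu f : measurable_fun [set: borel X] f -> bdd f ->
  \int[first_marginal mu]_x f x = \int[mu]_z f z.1.
Proof.
move=> mf bf; rewrite /Rintegral integral_distribution//.
- exact/measurable_EFinP.
- apply: (@bdd_integrable _ _ _ mu (f \o fst)); last exact: bdd_comp.
  exact: measurableT_comp mf fst_measurable.
Qed.

Lemma second_marginal_integral mu f :
  measurable_fun [set: borel X] f -> bdd f ->
  \int[second_marginal mu]_x f x = \int[mu]_z f z.2.
Proof.
move=> mf bf; rewrite /Rintegral integral_distribution//.
- exact/measurable_EFinP.
- apply: (@bdd_integrable _ _ _ mu (f \o snd)); last exact: bdd_comp.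
  exact: measurableT_comp mf snd_measurable.
Qed.

Lemma closed_measureP mu :
  closed_measure mu <->
  (forall f, continuous f -> \int[mu]_z f z.1 = \int[mu]_z f z.2).
Proof.
split => [cmu f cf|H A mA].
  have mf := continuous_borel cf; have bf := continuous_bdd cf.
  rewrite -first_marginal_integral// -second_marginal_integral//.
  by congr fine; apply: eq_measure_integral => A mA _; exact: cmu.
apply: (@probability_eq_continuous R X
  (first_marginal mu) (second_marginal mu)) => //.
move=> f cf bf; have mf := continuous_borel cf.
by rewrite first_marginal_integral// second_marginal_integral// H.
Qed.

Lemma marginal1_integral mu f : measurable_fun [set: borel X] f -> bdd f ->
  (\int[marginal1 mu]_x (f x)%:E = (\int[first_marginal mu]_x f x)%:E)%E.
Proof.
by move=> mf bf; exact: (bdd_EFin_Rintegral (first_marginal mu) mf bf).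
Qed.

End Marginals.

(** * Mather measures from occupation measures of chains *)

Section Occupation.
Context {R : realType} {X : pmetricType R}.
Hypothesis X_compact : compact [set: X].
Variables (c : X * X -> R) (c0 : R).
Hypothesis c_cont : continuous c.

(** A family of finite backward chains [p i 0, ..., p i (n i)], whose [k]-th
    link goes from [p i k.+1] to [p i k] and carries the weight [w i k]. *)
Context {I : Type} (F : set_system I) {UF : UltraFilter F}.
Variables (n : I -> nat) (w : I -> nat -> R) (p : I -> nat -> X).

Definition total_weight i : R := \sum_(k < n i) w i k.

Definition occupation i (f : X * X -> R) : R :=
  (total_weight i)^-1 * \sum_(k < n i) w i k * f (p i k.+1, p i k).

Hypothesis w_mono : forall i k, 0 <= w i k.+1 <= w i k.
Hypothesis w0 : forall i, w i 0%N = 1.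
Hypothesis weight_infty : (total_weight i)^-1 @[i --> F] --> (0 : R).
Hypothesis weight_gt0 : \forall i \near F, 0 < total_weight i.

Let w_ge0 i k : 0 <= w i k.
Proof. by case: k => [|k]; [rewrite w0|have /andP[] := w_mono i k]. Qed.

Lemma occupation_mean : \forall i \near F, is_mean (occupation i).
Proof.
apply: filterS weight_gt0 => i Wi; split.
- rewrite /occupation; under eq_bigr do rewrite mulr1.
  by rewrite mulVf// gt_eqF.
- move=> f _ f0; apply: mulr_ge0; first by rewrite invr_ge0 ltW.
  by apply: sumr_ge0 => k _; rewrite mulr_ge0.
- move=> a f g _ _; rewrite /occupation.
  under eq_bigr do rewrite mulrDr mulrCA.
  by rewrite big_split/= -mulr_sumr; ring.
Qed.

(** The chains need not be closed, but by summation by parts the two marginals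
    of an occupation measure differ by a mass of order [1 / total_weight]. *)
Lemma occupation_boundary (f : X -> R) : bdd f ->
  occupation i (fun z => f z.1 - f z.2) @[i --> F] --> (0 : R).
Proof.
move=> [M fM].
have H : 2 * M * (total_weight i)^-1 @[i --> F] --> (0 : R).
  by rewrite -[X in _ --> X](mulr0 (2 * M)); apply: cvgM => //; exact: cvg_cst.
apply/norm_cvg0P; apply: (squeeze_cvgr _ (cvg_cst 0) H).
apply: filterS weight_gt0 => i Wi; rewrite normr_ge0/=.
rewrite /occupation/= normrM [X in X * _]ger0_norm ?invr_ge0 ?(ltW Wi)// mulrC.
rewrite ler_wpM2r ?invr_ge0 ?(ltW Wi)//.
have := @abel_bound _ (w i) (fun k => f (p i k)) M (n i) (w_mono i).
by rewrite w0 mulr1; apply.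
Qed.

Variables (v : X -> R) (C : R).
Hypothesis v_cont : continuous v.
Hypothesis v_sub : critical_subsolution c c0 v.
Hypothesis cost_bnd : \forall i \near F,
  \sum_(k < n i) w i k * (c (p i k.+1, p i k) + c0) <= C.

(** A limit of occupation measures is closed since the total weights tend to
    infinity, and its cost is at most [- c0] since the normalized costs stay
    bounded while the weights grow; a closed measure never costs less than
    [- c0], because a critical subsolution integrates to zero along it. *)
Lemma occupation_mather : exists2 mu, mather_measures c c0 mu &
  forall f : X -> R, continuous f ->
    (total_weight i)^-1 * (\sum_(k < n i) w i k * f (p i k.+1)) @[i --> F]
      --> \int[mu]_z f z.1.
Proof.
have PF : ProperFilter F by exact: ultra_proper.
have XX_compact := square_compact X_compact.
have XX_haus : hausdorff_space (X * X)%type.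
  by apply: prod_hausdorff; exact: metric_hausdorff.
pose L := ultralim F occupation.
have mL : is_mean L by exact: ultralim_mean occupation_mean.
have [mu muL] := mean_representation XX_compact XX_haus mL.
have occ_cvg f : bdd f -> occupation i f @[i --> F] --> L f.
  by move=> bf; exact: (ultralim_cvg occupation_mean bf).
have bc := square_bdd X_compact c_cont.
have c1 (f : X -> R) : continuous f -> continuous (fun z : X * X => f z.1).
  by move=> cf z; apply: continuous_comp; [exact: fst_continuous|exact: cf].
have c2 (f : X -> R) : continuous f -> continuous (fun z : X * X => f z.2).
  by move=> cf z; apply: continuous_comp; [exact: snd_continuous|exact: cf].
have L12 (f : X -> R) : continuous f -> L (fun z => f z.1) = L (fun z => f z.2).
  move=> cf.
  have b1 := comp_fst_bdd X_compact cf.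
  have b2 := comp_snd_bdd X_compact cf.
  apply/eqP; rewrite -subr_eq0; apply/eqP.
  have -> : L (fun z => f z.1) - L (fun z => f z.2) =
      L (fun z => f z.1 - f z.2).
    have [_ _ /(_ (-1) _ _ b2 b1)] := mL.
    under eq_fun do rewrite addrC mulN1r.
    by move=> ->; rewrite mulN1r addrC.
  have h := occupation_boundary (compact_continuous_bdd X_compact cf).
  apply: (cvg_unique (@Rhausdorff R) _ h); apply: occ_cvg.
  by have := bddD (-1) b2 b1; under eq_fun do rewrite addrC mulN1r.
exists mu; last first.
  move=> f cf; rewrite muL; last exact: c1.
  by apply: (occ_cvg (fun z => f z.1)); exact: comp_fst_bdd.
split.
  apply/(closed_measureP X_compact) => f cf.
  by rewrite !muL ?L12//; [exact: c2|exact: c1].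
rewrite (bdd_EFin_Rintegral mu (continuous_borel c_cont) bc) muL//; congr EFin.
have Lc0 : L (fun z => c z + c0) = L c + c0.
  by rewrite (meanD mL)// ?(mean_cst mL)//; exact: bdd_cst.
have bcc0 : bdd (fun z => c z + c0).
  by have := bddD 1 bc (bdd_cst c0); under eq_fun do rewrite mul1r.
suff : L (fun z => c z + c0) = 0 by rewrite Lc0; lra.
apply/eqP; rewrite eq_le; apply/andP; split.
  have H : C * (total_weight i)^-1 @[i --> F] --> (0 : R).
    by rewrite -[X in _ --> X](mulr0 C); apply: cvgM => //; exact: cvg_cst.
  have occ_le : \forall i \near F,
      occupation i (fun z => c z + c0) <= C * (total_weight i)^-1.
    apply: filterS2 weight_gt0 cost_bnd => i Wi Ci.
    by rewrite /occupation mulrC ler_wpM2r// invr_ge0 ltW.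
  exact: (filter_le_cvg PF (occ_cvg _ bcc0) H occ_le).
have bv1 := comp_fst_bdd X_compact v_cont.
have bv2 := comp_snd_bdd X_compact v_cont.
have <- : L (fun z => -1 * v z.1 + v z.2) = 0.
  by have [_ _ ->] := mL => //; rewrite L12//; ring.
apply: (le_mean mL) => //; first exact: bddD.
by move=> [x y] /=; have := v_sub x y; lra.
Qed.

End Occupation.

(** * The Lax-Oleinik operator *)

Section CostModulus.
Context {R : realType} {X : pmetricType R}.
Hypothesis X_compact : compact [set: X].
Implicit Types c : X * X -> R.

Lemma cost_equicontinuous_snd c : continuous c -> forall (x : X) (e : R),
  0 < e -> \forall x' \near x, forall y, `|c (y, x) - c (y, x')| < e.
Proof.
move=> c_cont x e e0; have /compact_near_coveringP := X_compact.
move=> /(_ _ (nbhs x) (fun x' y => `|c (y, x) - c (y, x')| < e)) /(_ _) H.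
suff : \forall x' \near x,
    [set: X] `<=` (fun y => `|c (y, x) - c (y, x')| < e).
  by apply: filterS => x' + y; apply.
apply: H => y _.
have e20 : 0 < e / 2 by rewrite divr_gt0.
have : nbhs (y, x) [set z | `|c (y, x) - c z| < e / 2].
  by move/cvgrPdist_lt : (@c_cont (y, x)); apply.
move=> [[A B] /= [yA xB] AB]; exists (A, B) => //= -[y' x'] [/= Ay' Bx'].
have h1 : `|c (y, x) - c (y', x')| < e / 2 by exact: (AB (y', x')).
have h2 : `|c (y, x) - c (y', x)| < e / 2.
  by apply: (AB (y', x)); split => //=; exact: nbhs_singleton.
rewrite -(subrKA (c (y, x))) (le_lt_trans (ler_normD _ _))// [ltRHS]splitr.
by rewrite ltrD// distrC.
Qed.

Lemma cost_equicontinuous_fst c : continuous c -> forall (x : X) (e : R),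
  0 < e -> \forall x' \near x, forall y, `|c (x, y) - c (x', y)| < e.
Proof.
move=> c_cont; apply: (@cost_equicontinuous_snd (fun z => c (z.2, z.1))) => z.
apply: (@continuous_comp _ _ _ (fun z : X * X => (z.2, z.1)) c); last first.
  exact: c_cont.
by apply: cvg_pair; [exact: cvg_snd|exact: cvg_fst].
Qed.

End CostModulus.

Section LaxOleinik.
Context {R : realType} {X : pmetricType R}.
Hypothesis X_compact : compact [set: X].
Variables (c : X * X -> R) (c0 : R).
Hypothesis c_cont : continuous c.

Section LaxPair.
Variables (f u : X -> R).
Hypothesis fu : forall x, (u x)%:E = (lax_oleinik c f x + c0%:E)%E.

Lemma lax_le x y : u x <= f y + c (y, x) + c0.
Proof.
rewrite -lee_fin fu EFinD leeD2r//; apply: ereal_inf_lbound.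
by exists y.
Qed.

Lemma lax_ge x b : (forall y, b <= f y + c (y, x) + c0) -> b <= u x.
Proof.
move=> bf; rewrite -lee_fin fu -leeBlDr//; apply: le_ereal_inf_tmp.
by move=> _ [y _ <-]; rewrite -EFinB lee_fin lerBlDr.
Qed.

(** An infimum of translates of [c(y, .)] inherits their modulus of continuity,
    whatever [f] is. *)
Lemma lax_modulus x x' e : (forall y, `|c (y, x) - c (y, x')| < e) ->
  `|u x - u x'| <= e.
Proof.
move=> ce; rewrite ler_distl; apply/andP; split.
  rewrite lerBlDr -lerBlDr; apply: lax_ge => y.
  by have := lax_le x' y; have := ce y; rewrite ltr_distl => /andP[]; lra.
rewrite -lerBlDr; apply: lax_ge => y.
by have := lax_le x y; have := ce y; rewrite ltr_distl => /andP[]; lra.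
Qed.

Lemma lax_continuous : continuous u.
Proof.
move=> x; apply/cvgrPdist_lt => e e0.
have e20 : 0 < e / 2 by rewrite divr_gt0.
apply: filterS (cost_equicontinuous_snd X_compact c_cont x e20) => x' ce.
by rewrite (le_lt_trans (lax_modulus ce))// ltr_pdivrMr// ltr_pMr// ltr1n.
Qed.

Lemma lax_attained : continuous f ->
  exists back : X -> X, forall x, u x = f (back x) + c (back x, x) + c0.
Proof.
move=> cf.
suff : {back : X -> X & forall x, u x = f (back x) + c (back x, x) + c0}.
  by case=> back; exists back.
apply: (@choice _ _ (fun x y => u x = f y + c (y, x) + c0)) => x.
have g_cont : continuous (fun y => f y + c (y, x)).
  move=> y; apply: cvgD; first exact: cf.
  apply: (@continuous_comp _ _ _ (fun y => (y, x)) c); last exact: c_cont.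
  by apply: cvg_pair; [exact: cvg_id|exact: cvg_cst].
have [|y _ ymin] := compact_EVT_min _ X_compact (continuous_subspaceT g_cont).
  by exists x.
exists y; apply/eqP; rewrite eq_le lax_le/=.
by apply: lax_ge => z; rewrite lerD2r ymin// inE.
Qed.

End LaxPair.

End LaxOleinik.

(** * Discount weights along a chain *)

Section DiscountWeights.
Context {R : realType} {X : Type}.
Variables (alpha : X -> R) (l : R).
Hypothesis alpha_bnd : forall x, 0 <= alpha x < 1.
Hypothesis l01 : 0 < l < 1.
Implicit Types p : nat -> X.

Definition discount p n : R := \prod_(k < n) (1 - l * alpha (p k.+1)).

Lemma discount0 p : discount p 0 = 1. Proof. by rewrite /discount big_ord0. Qed.

Lemma discountS p n :
  discount p n.+1 = discount p n * (1 - l * alpha (p n.+1)).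
Proof. by rewrite /discount big_ord_recr. Qed.

Let factor01 x : 0 <= 1 - l * alpha x <= 1.
Proof.
have /andP[l0 l1] := l01; have /andP[a0 a1] := alpha_bnd x.
rewrite subr_ge0 gerBl mulr_ge0 ?(ltW l0)// andbT.
by rewrite mulr_ile1// ltW.
Qed.

Lemma discount_mono p n : 0 <= discount p n.+1 <= discount p n.
Proof.
have ge0 m : 0 <= discount p m.
  by apply: prodr_ge0 => k _; have /andP[] := factor01 (p k.+1).
rewrite ge0/= discountS -[leRHS]mulr1 ler_wpM2l//.
by have /andP[] := factor01 (p n.+1).
Qed.

Lemma discount_ge0 p n : 0 <= discount p n.
Proof.
by case: n => [|n]; [rewrite discount0|have /andP[] := discount_mono p n].
Qed.

Lemma discount_le1 p n : discount p n <= 1.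
Proof.
elim: n => [|n IH]; first by rewrite discount0.
by rewrite (le_trans _ IH)//; have /andP[] := discount_mono p n.
Qed.

(** A quantitative form of the fact that a product of factors [1 - t_k] tends to
    zero when the [t_k] have an infinite sum. *)
Lemma discount_le_inv p n :
  discount p n * (1 + l * \sum_(k < n) alpha (p k.+1)) <= 1.
Proof.
elim: n => [|n IH]; first by rewrite discount0 big_ord0 mulr0 addr0 mulr1.
apply: le_trans IH; rewrite discountS big_ord_recr/= -mulrA.
apply: ler_wpM2l; first exact: discount_ge0.
have /andP[l0 l1] := l01; have /andP[a0 a1] := alpha_bnd (p n.+1).
have s0 : 0 <= \sum_(k < n) alpha (p k.+1).
  by apply: sumr_ge0 => k _; have /andP[] := alpha_bnd (p k.+1).
have la0 : 0 <= l * alpha (p n.+1) by rewrite mulr_ge0// ltW.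
have ls0 : 0 <= l * \sum_(k < n) alpha (p k.+1) by rewrite mulr_ge0// ltW.
rewrite mulrDr; nra.
Qed.

Lemma sum_discount p n :
  l * \sum_(k < n) discount p k * alpha (p k.+1) = 1 - discount p n.
Proof.
elim: n => [|n IH]; first by rewrite big_ord0 discount0 mulr0 subrr.
by rewrite big_ord_recr/= mulrDr IH discountS; ring.
Qed.

Lemma discount_vanish p :
  (forall A, exists n, A < \sum_(k < n) alpha (p k.+1)) ->
  forall e, 0 < e -> exists n, discount p n <= e.
Proof.
move=> sum_infty e e0; have /andP[l0 l1] := l01.
have [n nA] := sum_infty (e^-1 / l); exists n.
have : discount p n * e^-1 <= 1.
  apply: le_trans (discount_le_inv p n); apply: ler_wpM2l.
    exact: discount_ge0.
  move: nA; rewrite ltr_pdivrMr// mulrC => /ltW h.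
  by rewrite (le_trans h)// lerDr.
by rewrite ler_pdivrMr// mul1r.
Qed.

(** Comparison principle: iterating the one-step inequality along the chain
    gives [d 0 >= discount n * d n >= - D * discount n], and the last term can be
    made arbitrarily small. *)
Lemma discount_comparison p (d : nat -> R) D :
  (forall e, 0 < e -> exists n, discount p n <= e) ->
  (forall n, - D <= d n) ->
  (forall n, (1 - l * alpha (p n.+1)) * d n.+1 <= d n) -> 0 <= d 0%N.
Proof.
move=> vanish dD dstep.
have dn n : discount p n * d n <= d 0%N.
  elim: n => [|n IH]; first by rewrite discount0 mul1r.
  by apply: le_trans IH; rewrite discountS -mulrA ler_wpM2l// discount_ge0.
apply/ler_addgt0Pr => e e0.
have D0 : 0 < `|D| + 1 by rewrite ltr_wpDl.
have [n ne] := vanish (e / (`|D| + 1)) (divr_gt0 e0 D0).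
have h1 : - (discount p n * (`|D| + 1)) <= discount p n * d n.
  rewrite -mulrN ler_wpM2l// ?discount_ge0// (le_trans _ (dD n))// lerN2.
  by rewrite (le_trans (ler_norm D))// lerDl.
have h2 : discount p n * (`|D| + 1) <= e by rewrite -ler_pdivlMr.
have := dn n; lra.
Qed.

End DiscountWeights.

(** * Discounted solutions *)

Section Setting.
Context {R : realType} {X : pmetricType R}.
Hypothesis X_compact : compact [set: X].
Variables (c : X * X -> R) (c0 : R) (alpha : X -> R).
Hypothesis c_cont : continuous c.
Hypothesis c0_critical : is_critical_constant c c0.
Hypothesis alpha_cont : continuous alpha.
Hypothesis alpha_bnd : forall x, 0 <= alpha x < 1.
Hypothesis alpha_mather : forall mu, mather_measures c c0 mu ->
  (0 < \int[marginal1 mu]_x (alpha x)%:E)%E.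

Local Notation step p k := (c (p k.+1, p k) + c0).

Lemma critical_solution : exists v : X -> R,
  [/\ continuous v, critical_subsolution c c0 v &
    exists back : X -> X, forall x, v x = v (back x) + c (back x, x) + c0].
Proof.
have [v vsol] := c0_critical.
have cv := lax_continuous X_compact c_cont vsol.
exists v; split=> //; last exact: lax_attained.
by move=> x y; have := lax_le vsol y x; lra.
Qed.

Lemma alpha_mather_gt0 mu : mather_measures c c0 mu ->
  0 < \int[mu]_z alpha z.1.
Proof.
move=> /alpha_mather; have ba := continuous_bdd X_compact alpha_cont.
have ma := continuous_borel alpha_cont.
by rewrite marginal1_integral// lte_fin first_marginal_integral.
Qed.

(** This is how the positivity of [alpha] on Mather measures makes up for the
    zeros of [alpha]: the empirical measures of a chain of bounded cost with
    bounded sums of [alpha] would accumulate at a Mather measure that does not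
    charge [alpha]. *)
Lemma alpha_sum_unbounded (p : nat -> X) A C :
  (forall n, \sum_(k < n) alpha (p k.+1) <= A) ->
  (forall n, \sum_(k < n) step p k <= C) -> False.
Proof.
move=> sumA sumC.
have [v [v_cont v_sub _]] := critical_solution.
have [F [UF ooF]] : exists F, UltraFilter F /\ \oo `<=` F.
  exact: ultraFilterLemma.
have PF : ProperFilter F by exact: ultra_proper.
have tot n : total_weight id (fun _ _ => 1 : R) n = n%:R.
  by rewrite /total_weight sumr_const card_ord.
have inv0 : (n%:R : R)^-1 @[n --> F] --> (0 : R).
  have h : (n%:R : R)^-1 @[n --> \oo] --> (0 : R).
    apply/gtr0_cvgV0; last exact: cvgr_idn.
    by near=> n; rewrite ltr0n; near: n; exact: nbhs_infty_gt.
  by move=> B /h; exact: ooF.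
have pos : \forall n \near F, (0 : R) < n%:R.
  by apply: ooF; near=> n; rewrite ltr0n; near: n; exact: nbhs_infty_gt.
have [] := @occupation_mather R X X_compact c c0 c_cont nat F UF id
  (fun _ _ => 1) (fun _ => p) _ _ _ _ v C v_cont v_sub.
- by move=> i k; rewrite ler01 lexx.
- by [].
- by under eq_fun do rewrite tot.
- by apply: filterS pos => n; rewrite tot.
- by apply: nearW => n; under eq_bigr do rewrite mul1r.
move=> mu mmu /(_ alpha alpha_cont) mu_alpha.
suff : \int[mu]_z alpha z.1 <= 0 by rewrite leNgt alpha_mather_gt0.
have H : A * (n%:R)^-1 @[n --> F] --> (0 : R).
  by rewrite -[X in _ --> X](mulr0 A); apply: cvgM => //; exact: cvg_cst.
apply: (filter_le_cvg PF mu_alpha H); apply: filterS pos => n n0.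
rewrite tot mulrC ler_wpM2r ?invr_ge0 ?(ltW n0)//.
by under eq_bigr do rewrite mul1r; exact: sumA.
Unshelve. all: by end_near. Qed.

Lemma discount_vanish_bounded (l : R) (p : nat -> X) : 0 < l < 1 ->
  (forall A, (forall n, \sum_(k < n) alpha (p k.+1) <= A) ->
    exists C, forall n, \sum_(k < n) step p k <= C) ->
  forall e, 0 < e -> exists n, discount alpha l p n <= e.
Proof.
move=> l01 cost; apply: discount_vanish => // A; apply: contrapT => nA.
have leA n : \sum_(k < n) alpha (p k.+1) <= A.
  by rewrite leNgt; apply/negP => h; apply: nA; exists n.
by have [C] := cost A leA; exact: alpha_sum_unbounded leA.
Qed.

Section Discounted.
Variables (l : R) (u : X -> R).
Hypothesis l01 : 0 < l < 1.
Hypothesis u_sol : discounted_solution c c0 alpha l u.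

Lemma discounted_continuous : continuous u.
Proof. exact: lax_continuous u_sol. Qed.

Lemma discounted_le x y : u x <= (1 - l * alpha y) * u y + (c (y, x) + c0).
Proof. by have := lax_le u_sol x y; lra. Qed.

Lemma discounted_chain x : exists p : nat -> X,
  p 0%N = x /\
  forall k, u (p k) = (1 - l * alpha (p k.+1)) * u (p k.+1) + step p k.
Proof.
have [|back backE] := lax_attained X_compact c_cont u_sol.
  move=> y; apply: cvgM; last exact: discounted_continuous.
  apply: cvgB; first exact: cvg_cst.
  by apply: cvgM; [exact: cvg_cst|exact: alpha_cont].
exists (fun k => iter k back x); split => // k.
by rewrite [LHS]backE iterS addrA.
Qed.

(** By telescoping the discounted equation, the cost of a calibrated chain is
    bounded as long as the sums of [alpha] along it are. *)
Lemma discounted_chain_vanish (p : nat -> X) :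
  (forall k, u (p k) = (1 - l * alpha (p k.+1)) * u (p k.+1) + step p k) ->
  forall e, 0 < e -> exists n, discount alpha l p n <= e.
Proof.
move=> pu; apply: discount_vanish_bounded => // A leA.
have [U uU] := continuous_bdd X_compact discounted_continuous.
have U0 : 0 <= U by exact: le_trans (uU (p 0%N)).
have /andP[l0 l1] := l01.
exists (2 * U + U * A) => n.
suff h : \sum_(k < n) step p k <=
    u (p 0%N) - u (p n) + U * \sum_(k < n) alpha (p k.+1).
  apply: (le_trans h); rewrite lerD ?ler_wpM2l//.
  have := uU (p 0%N); have := uU (p n).
  by rewrite !ler_norml => /andP[? ?] /andP[? ?]; lra.
elim: n => [|n IH]; first by rewrite !big_ord0 subrr mulr0 addr0.
rewrite !big_ord_recr/= mulrDr.
have h1 : step p n <= u (p n) - u (p n.+1) + U * alpha (p n.+1); last first.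
  by move: IH h1; lra.
have := pu n; have /andP[a0 a1] := alpha_bnd (p n.+1).
have : l * alpha (p n.+1) * u (p n.+1) <= alpha (p n.+1) * U.
  rewrite -mulrA mulrCA; apply: ler_wpM2l => //.
  rewrite (le_trans (ler_norm _))// normrM gtr0_norm//.
  by rewrite -[leRHS]mul1r ler_pM// ltW.
by lra.
Qed.

Lemma discounted_expand (p : nat -> X) n :
  (forall k, u (p k) = (1 - l * alpha (p k.+1)) * u (p k.+1) + step p k) ->
  u (p 0%N) = discount alpha l p n * u (p n) +
    \sum_(k < n) discount alpha l p k * step p k.
Proof.
move=> pu; elim: n => [|n IH]; first by rewrite discount0 big_ord0 mul1r addr0.
by rewrite IH big_ord_recr/= discountS {1}pu; ring.
Qed.

(** The critical solution shifted to be nonpositive (resp. nonnegative) is a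
    subsolution (resp. supersolution) of the discounted equation.  The
    comparison is run along a calibrated chain of [u] for the lower bound and of
    [v] for the upper bound; the bound does not depend on [l]. *)
Lemma discounted_bound v W x : continuous v -> critical_subsolution c c0 v ->
  (exists back : X -> X, forall x, v x = v (back x) + c (back x, x) + c0) ->
  (forall x, `|v x| <= W) -> `|u x| <= 2 * W.
Proof.
move=> v_cont v_sub [back backE] vW.
have W0 : 0 <= W by exact: le_trans (vW x).
have vW' y : - W <= v y <= W by rewrite -ler_norml.
have la0 y : 0 <= l * alpha y.
  have /andP[? _] := l01; have /andP[? _] := alpha_bnd y.
  by rewrite mulr_ge0// ltW.
have [U uU] := continuous_bdd X_compact discounted_continuous.
have uU' y : - U <= u y <= U by rewrite -ler_norml.
rewrite ler_norml; apply/andP; split.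
  have [p [p0 pu]] := discounted_chain x.
  have : 0 <= u (p 0%N) - (v (p 0%N) - W).
    apply: (@discount_comparison R X alpha l alpha_bnd l01 p
      (fun n => u (p n) - (v (p n) - W)) U).
    - exact: discounted_chain_vanish.
    - by move=> n; have := uU' (p n); have := vW' (p n); lra.
    - move=> n; rewrite (pu n).
      have := v_sub (p n.+1) (p n); have := vW' (p n.+1); have := la0 (p n.+1).
      by nra.
  by rewrite p0; have := vW' x; lra.
pose p n := iter n back x.
have pv k : v (p k) = v (p k.+1) + step p k by rewrite [LHS]backE addrA.
have : 0 <= (v (p 0%N) + W) - u (p 0%N).
  apply: (@discount_comparison R X alpha l alpha_bnd l01 p
    (fun n => (v (p n) + W) - u (p n)) U).
  - apply: discount_vanish_bounded => // A _; exists (2 * W) => n.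
    suff -> : \sum_(k < n) step p k = v (p 0%N) - v (p n).
      by have := vW' (p n); have := vW' (p 0%N); lra.
    elim: n => [|n IH]; first by rewrite big_ord0 subrr.
    by rewrite big_ord_recr/= IH; have := pv n; lra.
  - by move=> n; have := uU' (p n); have := vW' (p n); lra.
  - move=> n; have := discounted_le (p n) (p n.+1); rewrite (pv n).
    by have := vW' (p n.+1); have := la0 (p n.+1); nra.
by rewrite /p/=; have := vW' x; lra.
Qed.

End Discounted.

End Setting.

(** * The Peierls barrier *)

Section Peierls.
Context {R : realType} {X : pmetricType R}.
Hypothesis X_compact : compact [set: X].
Variables (c : X * X -> R) (c0 : R).
Hypothesis c_cont : continuous c.
Hypothesis c0_critical : is_critical_constant c c0.
Variable x0 : X.
Local Open Scope ereal_scope.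

Definition normalized_cost n x : \bar R :=
  chain_cost c n x x0 + (n%:R * c0)%:E.

Lemma normalized_cost_le_chain (p : nat -> X) n : p 0%N = x0 ->
  normalized_cost n (p n) <= (\sum_(k < n) (c (p k.+1, p k) + c0))%:E.
Proof.
move=> p0; rewrite big_split/= sumr_const card_ord -[(_ *+ n)%R]mulr_natl EFinD.
apply: leeD2r; apply: ereal_inf_lbound.
exists (fun i => p (n - i)%N); first by rewrite /= subn0 subnn.
congr EFin; rewrite [RHS](reindex_inj rev_ord_inj)/=.
apply: eq_bigr => i _; congr (c (p _, p _)).
by rewrite subnSK.
Qed.

Lemma normalized_cost_ge (v : X -> R) n x : critical_subsolution c c0 v ->
  (v x0 - v x)%:E <= normalized_cost n x.
Proof.
move=> v_sub; rewrite -leeBlDr//; apply: le_ereal_inf_tmp.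
move=> _ [p [p0 pn] <-]; rewrite -EFinB lee_fin -p0 -pn lerBlDr {p0 pn}.
elim: n => [|n IH]; first by rewrite big_ord0 subrr mul0r addr0.
by rewrite big_ord_recr/= -natr1; have := v_sub (p n) (p n.+1); lra.
Qed.

(** Moving the starting point only affects the first link, which exists as soon
    as the chain is not empty. *)
Lemma normalized_cost_modulus n x x' e :
  (forall y, c (x, y) <= c (x', y) + e)%R ->
  normalized_cost n.+1 x <= normalized_cost n.+1 x' + e%:E.
Proof.
move=> ce; rewrite /normalized_cost addeAC; apply: leeD2r.
rewrite -leeBlDr//; apply: le_ereal_inf_tmp => _ [p [p0 pn] <-].
rewrite leeBlDr//; apply: (@le_trans _ _ (\sum_(i < n.+1)
    c (if i == 0%N :> nat then x else p i, p i.+1))%:E).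
  apply: ereal_inf_lbound; exists (fun i => if i == 0%N then x else p i) => //=.
rewrite -EFinD lee_fin !big_ord_recl/= p0 addrAC lerD2r.
exact: ce.
Qed.

(** Below by any subsolution; above by the backward calibrated chain of the
    critical solution from [x0], with its far end moved to [x]. *)
Lemma normalized_cost_bounded : exists B : R, forall n x,
  (- B)%:E <= normalized_cost n.+1 x <= B%:E.
Proof.
have [v [v_cont v_sub [back backE]]] :=
  critical_solution X_compact c_cont c0_critical.
have [W vW] := continuous_bdd X_compact v_cont.
have [D cD] := square_bdd X_compact c_cont.
have vW' y : (- W <= v y <= W)%R by rewrite -ler_norml.
have cD' z : (- D <= c z <= D)%R by rewrite -ler_norml.
exists (2 * W + 2 * D)%R => n x; apply/andP; split.
  apply: le_trans (normalized_cost_ge n.+1 x v_sub); rewrite lee_fin.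
  by have := vW' x; have := vW' x0; have := cD' (x, x); lra.
pose p k := iter k back x0.
have pn : (\sum_(k < n.+1) (c (p k.+1, p k) + c0) = v (p 0%N) - v (p n.+1))%R.
  elim: n.+1 => [|m IH]; first by rewrite big_ord0 subrr.
  by rewrite big_ord_recr/= IH; have := backE (p m); rewrite /p/=; lra.
have := @normalized_cost_le_chain p n.+1 erefl; rewrite pn => h.
apply: (@le_trans _ _ (normalized_cost n.+1 (p n.+1) + (2 * D)%:E)).
  apply: normalized_cost_modulus => y.
  by have := cD' (x, y); have := cD' (p n.+1, y); lra.
rewrite (le_trans (leeD2r _ h))// -EFinD lee_fin.
by have := vW' (p n.+1); have := vW' x0; rewrite /p/=; lra.
Qed.

(** The infimum over chains with more than [N] links.  The shift by one excludes
    the empty chain, whose cost is infinite unless [x = x0]; these functions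
    increase to the barrier and, unlike the cost of a fixed length, bound from
    below all long chains at once. *)
Definition tail_cost N x : R := fine (einfs (normalized_cost ^~ x) N.+1).

Lemma tail_cost_bounded : exists B : R, forall N x,
  einfs (normalized_cost ^~ x) N.+1 = (tail_cost N x)%:E /\
  (`|tail_cost N x| <= B)%R.
Proof.
have [B nB] := normalized_cost_bounded; exists B => N x.
have lB : (- B)%:E <= einfs (normalized_cost ^~ x) N.+1.
  apply: le_ereal_inf_tmp => _ [[//|k] _ <-].
  by have /andP[] := nB k x.
have uB : einfs (normalized_cost ^~ x) N.+1 <= B%:E.
  apply: (@le_trans _ _ (normalized_cost N.+1 x)); last first.
    by have /andP[] := nB N x.
  by apply: ereal_inf_lbound; exists N.+1 => /=.
have fin : einfs (normalized_cost ^~ x) N.+1 \is a fin_num.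
  rewrite fin_numE; apply/andP; split; apply/negP => /eqP E;
    by rewrite E in lB uB.
split; first by rewrite fineK.
by rewrite ler_norml -!lee_fin fineK// lB uB.
Qed.

Lemma tail_costE N x : einfs (normalized_cost ^~ x) N.+1 = (tail_cost N x)%:E.
Proof. by have [B /(_ N x)[]] := tail_cost_bounded. Qed.

Lemma tail_cost_le N n x : (N < n)%N ->
  (tail_cost N x)%:E <= normalized_cost n x.
Proof.
by move=> Nn; rewrite -tail_costE; apply: ereal_inf_lbound; exists n.
Qed.

Lemma tail_cost_modulus N x x' e :
  (forall y, c (x, y) <= c (x', y) + e)%R ->
  (tail_cost N x <= tail_cost N x' + e)%R.
Proof.
move=> ce; rewrite -lerBlDr -lee_fin -[X in _ <= X]tail_costE.
apply: le_ereal_inf_tmp => _ [[//|k] /= Nk <-].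
rewrite EFinB leeBlDr//; apply: le_trans (normalized_cost_modulus k ce).
exact: tail_cost_le.
Qed.

Lemma tail_cost_continuous N : continuous (tail_cost N).
Proof.
move=> x; apply/cvgrPdist_lt => e e0.
have e20 : (0 < e / 2)%R by rewrite divr_gt0.
apply: filterS (cost_equicontinuous_fst X_compact c_cont x e20) => x' ce.
have h1 : (tail_cost N x <= tail_cost N x' + e / 2)%R.
  apply: tail_cost_modulus => y; have := ce y.
  by rewrite ltr_distl => /andP[]; lra.
have h2 : (tail_cost N x' <= tail_cost N x + e / 2)%R.
  apply: tail_cost_modulus => y; have := ce y.
  by rewrite ltr_distl => /andP[]; lra.
by rewrite ltr_distl; apply/andP; split; lra.
Qed.

Definition barrier x : R := fine (peierls_barrier c c0 x x0).

Lemma tail_cost_cvg_barrier x :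
  peierls_barrier c c0 x x0 = (barrier x)%:E /\
  (tail_cost N x @[N --> \oo] --> barrier x)%R.
Proof.
have [B tB] := tail_cost_bounded.
have hE : peierls_barrier c c0 x x0 = limn (einfs (normalized_cost ^~ x)).
  by rewrite /peierls_barrier limn_einf_lim.
have : einfs (normalized_cost ^~ x) N @[N --> \oo] -->
    peierls_barrier c c0 x x0.
  by rewrite hE; exact: is_cvg_einfs.
rewrite -(cvg_shiftS (einfs _)) => h.
have h' : (tail_cost N x)%:E @[N --> \oo] --> peierls_barrier c c0 x x0.
  by under eq_fun do rewrite -tail_costE.
have fin : peierls_barrier c c0 x x0 \is a fin_num.
  rewrite fin_numElt; apply/andP; split.
    apply: (@lt_le_trans _ _ (- B)%:E); first exact: ltNyr.
    apply: (cvge_ge _ h'); apply: nearW => N; rewrite lee_fin.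
    by have [_] := tB N x; rewrite ler_norml => /andP[].
  apply: (@le_lt_trans _ _ B%:E); last exact: ltry.
  apply: (cvge_le _ h'); apply: nearW => N; rewrite lee_fin.
  by have [_] := tB N x; rewrite ler_norml => /andP[].
split; first by rewrite /barrier fineK.
by move: h'; rewrite -{1}(fineK fin) => /fine_cvgP[].
Qed.

Lemma barrier_ge (v : X -> R) x : critical_subsolution c c0 v ->
  (v x0 - v x <= barrier x)%R.
Proof.
move=> v_sub; have [_ h] := tail_cost_cvg_barrier x.
apply: (cvgr_to_ge h); apply: nearW => N.
rewrite -lee_fin -tail_costE; apply: le_ereal_inf_tmp => _ [k _ <-].
exact: normalized_cost_ge.
Qed.

Lemma barrier_bdd : bdd barrier.
Proof.
have [B tB] := tail_cost_bounded; exists B => x.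
have [_ h] := tail_cost_cvg_barrier x.
rewrite ler_norml; apply/andP; split.
  apply: (cvgr_to_ge h); apply: nearW => N.
  by have [_] := tB N x; rewrite ler_norml => /andP[].
apply: (cvgr_to_le h); apply: nearW => N.
by have [_] := tB N x; rewrite ler_norml => /andP[].
Qed.

Lemma barrier_measurable : measurable_fun [set: borel X] barrier.
Proof.
apply: (@measurable_fun_cvg _ (borel X) R setT (fun N => tail_cost N)) => //.
- by move=> N; exact: (continuous_borel (@tail_cost_continuous N)).
- by move=> x _; have [] := tail_cost_cvg_barrier x.
Qed.

End Peierls.

(** * Limits of discounted solutions along an ultrafilter *)

Section Limit.
Context {R : realType} {X : pmetricType R}.
Hypothesis X_compact : compact [set: X].
Variables (c : X * X -> R) (c0 : R) (alpha : X -> R).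
Hypothesis c_cont : continuous c.
Hypothesis c0_critical : is_critical_constant c c0.
Hypothesis alpha_cont : continuous alpha.
Hypothesis alpha_bnd : forall x, 0 <= alpha x < 1.
Hypothesis alpha_mather : forall mu, mather_measures c c0 mu ->
  (0 < \int[marginal1 mu]_x (alpha x)%:E)%E.
Variable u : R -> X -> R.
Hypothesis u_sol : forall l, 0 < l < 1 ->
  discounted_solution c c0 alpha l (u l).

Local Notation step p k := (c (p k.+1, p k) + c0).
Local Notation disc := (discount alpha).

Lemma discounted_family_bdd : exists M, forall l x, 0 < l < 1 -> `|u l x| <= M.
Proof.
have [v [v_cont v_sub vback]] := critical_solution X_compact c_cont c0_critical.
have [W vW] := continuous_bdd X_compact v_cont.
exists (2 * W) => l x l01.
exact: (discounted_bound X_compact c_cont c0_critical alpha_cont alpha_bnd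
  alpha_mather l01 (u_sol l01) x v_cont v_sub vback vW).
Qed.

(** Up to the total cost, discounted by the last weight, summation by parts
    turns the discounted cost of a chain into an average of the undiscounted
    costs of its final segments; the weights involve [alpha] exactly as in the
    limit formula. *)
Lemma sum_step_abel l (p : nat -> X) n :
  \sum_(k < n) disc l p k * step p k =
  disc l p n * (\sum_(j < n) step p j) +
  l * \sum_(k < n) disc l p k * (alpha (p k.+1) * \sum_(j < k.+1) step p j).
Proof.
elim: n => [|n IH]; first by rewrite !big_ord0 !mulr0 addr0.
have -> : \sum_(k < n.+1) disc l p k *
      (alpha (p k.+1) * \sum_(j < k.+1) step p j) =
    \sum_(k < n) disc l p k * (alpha (p k.+1) * \sum_(j < k.+1) step p j) +
    disc l p n * (alpha (p n.+1) * (\sum_(j < n) step p j + step p n)).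
  rewrite big_ord_recr/=; congr (_ + _ * (_ * _)).
  by rewrite big_ord_recr.
by rewrite big_ord_recr/= IH [in RHS]big_ord_recr/= discountS; ring.
Qed.

(** The final segment starting at [p k.+1] costs at least [tail_cost N] as soon
    as it has more than [N] links.  The [N] shorter segments have weight at most
    [l] each, and the remainder at the far end has weight [disc l p n <= l]. *)
Lemma discounted_lower x0 N : exists K, forall l (p : nat -> X) n,
  0 < l < 1 -> p 0%N = x0 -> disc l p n <= l ->
  (forall k, u l (p k) = (1 - l * alpha (p k.+1)) * u l (p k.+1) + step p k) ->
  l * (\sum_(k < n) disc l p k *
    (alpha (p k.+1) * tail_cost c c0 x0 N (p k.+1))) - l * K <= u l x0.
Proof.
have [M uM] := discounted_family_bdd.
have [v [v_cont v_sub _]] := critical_solution X_compact c_cont c0_critical.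
have [W vW] := continuous_bdd X_compact v_cont.
have [B tB] := tail_cost_bounded X_compact c_cont c0_critical x0.
have M0 : 0 <= M.
  apply: le_trans (uM (2^-1) x0 _); rewrite ?normr_ge0//.
  by rewrite invr_gt0 ltr0n invf_lt1// ltr1n.
have W0 : 0 <= W by exact: le_trans (vW x0).
have B0 : 0 <= B by have [_] := tB 0%N x0; exact: le_trans.
exists (M + 2 * W + N%:R * (2 * W + B)) => l p n l01 p0 pn pu.
have /andP[l0 l1] := l01.
have S_ge k : - (2 * W) <= \sum_(j < k) step p j.
  have h := @normalized_cost_le_chain R X c c0 x0 p k p0.
  have := le_trans (normalized_cost_ge x0 k (p k) v_sub) h; rewrite lee_fin.
  have := vW x0; have := vW (p k).
  by rewrite !ler_norml => /andP[? ?] /andP[? ?]; lra.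
have S_tail k : tail_cost c c0 x0 N (p k.+1) - (k < N)%N%:R * (2 * W + B)
    <= \sum_(j < k.+1) step p j.
  have [kN|Nk] := ltnP k N.
    have := S_ge k.+1; have [_] := tB N (p k.+1).
    by rewrite mul1r ler_norml => /andP[? ?]; lra.
  rewrite mul0r subr0 -lee_fin.
  apply: le_trans (@normalized_cost_le_chain R X c c0 x0 p k.+1 p0).
  exact: (tail_cost_le X_compact c_cont c0_critical).
have cardN m : \sum_(k < m) (k < N)%N%:R <= N%:R :> R.
  suff -> : \sum_(k < m) (k < N)%N%:R = (minn m N)%:R :> R.
    by rewrite ler_nat geq_minr.
  elim: m => [|m IH]; first by rewrite big_ord0 min0n.
  rewrite big_ord_recr/= IH -natrD; congr (_%:R).
  have [mN|Nm] := ltnP m N.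
    by rewrite (minn_idPl mN) addn1.
  by rewrite (minn_idPr (leqW Nm)) addn0.
have := discounted_expand n pu; rewrite p0 sum_step_abel => uE.
have b0 := discount_ge0 alpha_bnd l01 p.
have b1 := discount_le1 alpha_bnd l01 p.
have H1 : - (l * (M + 2 * W)) <=
    disc l p n * u l (p n) + disc l p n * (\sum_(j < n) step p j).
  rewrite -mulrDr; apply: (@le_trans _ _ (disc l p n * - (M + 2 * W))).
    by rewrite mulrN lerN2 ler_wpM2r// addr_ge0// mulr_ge0.
  rewrite ler_wpM2l//; have := S_ge n; have := uM l (p n) l01.
  by rewrite ler_norml => /andP[? ?]; lra.
have H2 : \sum_(k < n) disc l p k *
      (alpha (p k.+1) * tail_cost c c0 x0 N (p k.+1)) - N%:R * (2 * W + B) <=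
    \sum_(k < n) disc l p k * (alpha (p k.+1) * \sum_(j < k.+1) step p j).
  have WB0 : 0 <= 2 * W + B by rewrite addr_ge0// mulr_ge0.
  apply: (@le_trans _ _ (\sum_(k < n) disc l p k * (alpha (p k.+1) *
      tail_cost c c0 x0 N (p k.+1)) -
      (\sum_(k < n) (k < N)%N%:R) * (2 * W + B))).
    by rewrite lerD2l lerN2 ler_wpM2r.
  rewrite mulr_suml -sumrB; apply: ler_sum => k _.
  have /andP[a0 /ltW a1] := alpha_bnd (p k.+1).
  have ba0 : 0 <= disc l p k * alpha (p k.+1) by rewrite mulr_ge0.
  have ba1 : disc l p k * alpha (p k.+1) <= 1 by rewrite mulr_ile1.
  rewrite !mulrA; apply: le_trans (ler_wpM2l ba0 (S_tail k)).
  rewrite mulrBr lerD2l lerN2 -[leRHS]mul1r.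
  by rewrite ler_wpM2r// mulr_ge0.
have := ler_wpM2l (ltW l0) H2; rewrite mulrBr.
by rewrite uE; lra.
Qed.

Section UltraLimit.
Variable F : set_system R.
Context {UF : UltraFilter F}.
Hypothesis F0 : (0 : R)^'+ `<=` F.

Let PF : ProperFilter F. Proof. exact: ultra_proper. Qed.

Lemma near_ultra_small (e : R) : 0 < e -> \forall l \near F, 0 < l < e.
Proof.
move=> e0; apply: F0; near=> l; apply/andP; split; near: l.
- exact: nbhs_right_gt.
- exact: nbhs_right_lt.
Unshelve. all: by end_near. Qed.

Lemma cvg_ultra_id : l @[l --> F] --> (0 : R).
Proof.
by move=> A A0; apply: F0; exact: (cvg_at_right_filter cvg_id).
Qed.

Definition ulim x : R := lim (u l x @[l --> F]).

Lemma ulim_cvg x : u l x @[l --> F] --> ulim x.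
Proof.
have [M uM] := discounted_family_bdd.
suff : cvg (u l x @[l --> F]) by [].
apply: (@ultra_bounded_cvg _ _ _ _ M).
by apply: filterS (near_ultra_small ltr01) => l; exact: uM.
Qed.

(** The half of the barrier formula that requires constructing a measure: it is
    the limit of the occupation measures, with weights [disc], of calibrated
    chains ending at [x0].  By [sum_discount] the product of [l], of the total
    weight and of the average of [alpha] tends to 1, which turns the sums of
    [discounted_lower] into quotients of averages; [N] tends to infinity last. *)
Lemma selected_measure x0 : exists2 mu, mather_measures c c0 mu &
  \int[mu]_z (alpha z.1 * barrier c c0 x0 z.1) <=
    ulim x0 * \int[mu]_z alpha z.1.
Proof.
(* A chain must be chosen for every real l, also outside of ]0, 1[ *)
pose cut (l : R) : R := if 0 < l < 1 then l else 2^-1.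
have cut01 l : 0 < cut l < 1.
  by rewrite /cut; case: ifPn => // _; rewrite invr_gt0 ltr0n invf_lt1// ltr1n.
have cutE : \forall l \near F, cut l = l.
  by apply: filterS (near_ultra_small ltr01) => l h; rewrite /cut h.
have [pn pnP] : {pn : R -> (nat -> X) * nat & forall l,
    [/\ (pn l).1 0%N = x0, disc (cut l) (pn l).1 (pn l).2 <= cut l &
      forall k, u (cut l) ((pn l).1 k) = (1 - cut l * alpha ((pn l).1 k.+1)) *
        u (cut l) ((pn l).1 k.+1) + step (pn l).1 k]}.
  apply: (@choice _ _ (fun l pn =>
    [/\ pn.1 0%N = x0, disc (cut l) pn.1 pn.2 <= cut l &
      forall k, u (cut l) (pn.1 k) = (1 - cut l * alpha (pn.1 k.+1)) *
        u (cut l) (pn.1 k.+1) + step pn.1 k])) => l.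
  have sol := u_sol (cut01 l).
  have [p [p0 pu]] := discounted_chain X_compact c_cont alpha_cont sol x0.
  have /andP[cl0 _] := cut01 l.
  have [n nl] := discounted_chain_vanish X_compact c_cont c0_critical alpha_cont
    alpha_bnd alpha_mather (cut01 l) sol pu cl0.
  by exists (p, n).
pose p l := (pn l).1; pose n l := (pn l).2; pose w l := disc (cut l) (p l).
have p0 l : p l 0%N = x0 by have [] := pnP l.
have bl l : w l (n l) <= cut l by have [] := pnP l.
have pu l k : u (cut l) (p l k) = (1 - cut l * alpha (p l k.+1)) *
    u (cut l) (p l k.+1) + step (p l) k by have [_ _ h] := pnP l; exact: h.
have w_mono l k : 0 <= w l k.+1 <= w l k by exact: discount_mono.
have w_ge0 l k : 0 <= w l k by exact: (discount_ge0 alpha_bnd (cut01 l)).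
pose Z := total_weight n w.
have lZ l : 1 - cut l <= cut l * Z l.
  have /andP[cl0 _] := cut01 l.
  apply: (@le_trans _ _ (1 - w l (n l))); first by rewrite lerD2l lerN2.
  rewrite -(sum_discount alpha (cut l) (p l) (n l)) ler_wpM2l ?(ltW cl0)//.
  apply: ler_sum => k _; rewrite ler_piMr//; first exact: w_ge0.
  by have /andP[_ /ltW] := alpha_bnd (p l k.+1).
have Z_gt0 l : 0 < Z l.
  have /andP[cl0 cl1] := cut01 l.
  rewrite -(pmulr_rgt0 _ cl0); apply: lt_le_trans (lZ l).
  by rewrite subr_gt0.
have Z_near : \forall l \near F, 0 < Z l by exact: filterE.
have Z_inv0 : (Z l)^-1 @[l --> F] --> (0 : R).
  have H : 2 * l @[l --> F] --> (0 : R).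
    rewrite -[X in _ --> X](mulr0 2).
    by apply: cvgM; [exact: cvg_cst|exact: cvg_ultra_id].
  apply: (squeeze_cvgr _ (cvg_cst 0) H).
  have half0 : 0 < 2^-1 :> R by rewrite invr_gt0.
  apply: filterS2 (near_ultra_small half0) cutE => l /andP[l0 l2] cl.
  rewrite invr_ge0 ltW//= -[leLHS]mul1r ler_pdivrMr//.
  by have := lZ l; rewrite cl; nra.
have [M uM] := discounted_family_bdd.
have [v [v_cont v_sub _]] := critical_solution X_compact c_cont c0_critical.
have [|mu mmu muP] := @occupation_mather R X X_compact c c0 c_cont R F UF n w p
  w_mono (fun l => discount0 _ _ _) Z_inv0 Z_near v (2 * M) v_cont v_sub.
  apply: nearW => l.
  have E : u (cut l) x0 = w l (n l) * u (cut l) (p l (n l)) +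
      \sum_(k < n l) w l k * step (p l) k.
    by rewrite -(p0 l); exact: discounted_expand (pu l).
  have h1 := uM _ x0 (cut01 l); have h2 := uM _ (p l (n l)) (cut01 l).
  have w1 : w l (n l) <= 1 by exact: (discount_le1 alpha_bnd (cut01 l)).
  have : `|w l (n l) * u (cut l) (p l (n l))| <= M.
    by rewrite normrM (ger0_norm (w_ge0 _ _)) -[leRHS]mul1r ler_pM.
  move: h1 E; rewrite !ler_norml => /andP[? ?] E /andP[? ?].
  by lra.
exists mu => //.
have tail_le N : \int[mu]_z (alpha z.1 * tail_cost c c0 x0 N z.1) <=
    ulim x0 * \int[mu]_z alpha z.1.
  have [K lower] := discounted_lower x0 N.
  have t_cont : continuous (tail_cost c c0 x0 N) by exact: tail_cost_continuous.
  have at_cont : continuous (fun x => alpha x * tail_cost c c0 x0 N x).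
    by move=> x; apply: cvgM; [exact: alpha_cont|exact: t_cont].
  have A_cvg := muP _ at_cont; have D_cvg := muP _ alpha_cont.
  set A := fun l : R => _ in A_cvg; set D := fun l : R => _ in D_cvg.
  have beta0 : w l (n l) @[l --> F] --> (0 : R).
    apply: (squeeze_cvgr _ (cvg_cst 0) cvg_ultra_id).
    by apply: filterS cutE => l cl; rewrite w_ge0/= -[leRHS]cl.
  have lhs : (1 - w l (n l)) * A l - l * K * D l @[l --> F] -->
      (1 - 0) * \int[mu]_z (alpha z.1 * tail_cost c c0 x0 N z.1) -
      0 * K * \int[mu]_z alpha z.1.
    apply: cvgB.
      by apply: cvgM => //; apply: cvgB => //; exact: cvg_cst.
    by apply: cvgM => //; apply: cvgM; [exact: cvg_ultra_id|exact: cvg_cst].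
  have rhs : u l x0 * D l @[l --> F] --> ulim x0 * \int[mu]_z alpha z.1.
    by apply: cvgM => //; exact: ulim_cvg.
  rewrite subr0 mul1r !mul0r subr0 in lhs.
  apply: (filter_le_cvg PF lhs rhs); apply: filterS cutE => l cl.
  have D0 : 0 <= D l.
    rewrite /D mulr_ge0// ?invr_ge0 ?(ltW (Z_gt0 l))//.
    apply: sumr_ge0 => k _; rewrite mulr_ge0//.
    by have /andP[] := alpha_bnd (p l k.+1).
  have := lower _ _ _ (cut01 l) (p0 l) (bl l) (pu l); rewrite cl => low.
  have ZA : \sum_(k < n l) disc l (p l) k * (alpha (p l k.+1) *
      tail_cost c c0 x0 N (p l k.+1)) = Z l * A l.
    by rewrite /A mulrA mulfV ?gt_eqF// mul1r /w cl.
  have lZD : l * Z l * D l = 1 - w l (n l).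
    rewrite /D -mulrA [Z l * _]mulrA mulfV ?gt_eqF// mul1r /w cl.
    exact: sum_discount.
  rewrite -lZD; rewrite ZA in low.
  have := ler_wpM2r D0 low; nra.
have b_cvg : \int[mu]_z (alpha z.1 * tail_cost c c0 x0 N z.1) @[N --> \oo] -->
    \int[mu]_z (alpha z.1 * barrier c c0 x0 z.1).
  have [B tB] := tail_cost_bounded X_compact c_cont c0_critical x0.
  apply: (@bounded_convergence _ _ R mu
    (fun N z => alpha z.1 * tail_cost c c0 x0 N z.1)
    (fun z => alpha z.1 * barrier c c0 x0 z.1) B).
  - move=> N; apply: continuous_borel => z; apply: cvgM.
      by apply: continuous_comp; [exact: fst_continuous|exact: alpha_cont].
    apply: continuous_comp; first exact: fst_continuous.
    exact: tail_cost_continuous.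
  - apply: measurable_funM.
      exact: measurableT_comp (continuous_borel alpha_cont) fst_measurable.
    apply: measurableT_comp fst_measurable.
    exact: (barrier_measurable X_compact c_cont c0_critical).
  - move=> N z; have [_ tBz] := tB N z.1.
    have /andP[a0 /ltW a1] := alpha_bnd z.1.
    rewrite normrM (ger0_norm a0) (le_trans _ tBz)//.
    by rewrite -[leRHS]mul1r ler_wpM2r.
  - move=> z; apply: cvgM; first exact: cvg_cst.
    by have [] := tail_cost_cvg_barrier X_compact c_cont c0_critical x0 z.1.
by apply: (cvgr_to_le b_cvg); apply: nearW.
Qed.

Lemma ulim_modulus x (e : R) : 0 < e -> \forall x' \near x,
  (forall l, 0 < l < 1 -> `|u l x - u l x'| <= e) /\ `|ulim x - ulim x'| <= e.
Proof.
move=> e0.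
apply: filterS (cost_equicontinuous_snd X_compact c_cont x e0) => x' ce.
have ul l : 0 < l < 1 -> `|u l x - u l x'| <= e.
  by move=> l01; exact: lax_modulus (u_sol l01) _ _ _ ce.
split => //.
have h : `|u l x - u l x'| @[l --> F] --> `|ulim x - ulim x'|.
  by apply: cvg_norm; apply: cvgB; exact: ulim_cvg.
apply: (cvgr_to_le h); apply: filterS (near_ultra_small ltr01) => l.
exact: ul.
Qed.

Lemma ulim_continuous : continuous ulim.
Proof.
move=> x; apply/cvgrPdist_lt => e e0.
have e20 : 0 < e / 2 by rewrite divr_gt0.
apply: filterS (ulim_modulus x e20) => x' [_ h].
by rewrite (le_lt_trans h)// ltr_pdivrMr// ltr_pMr// ltr1n.
Qed.

(** The [u l] are equicontinuous, so on the compact space pointwise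
    convergence is uniform. *)
Lemma ulim_uniform (e : R) : 0 < e ->
  \forall l \near F, forall x, `|ulim x - u l x| < e.
Proof.
move=> e0; have /compact_near_coveringP := X_compact.
move=> /(_ _ F (fun l x => `|ulim x - u l x| < e)) /(_ _) H.
suff : \forall l \near F, [set: X] `<=` (fun x => `|ulim x - u l x| < e).
  by apply: filterS => l + x; apply.
apply: H => x _; have e40 : 0 < e / 4 by rewrite divr_gt0.
have hx : \forall l \near F, `|ulim x - u l x| < e / 4.
  by have /cvgrPdist_lt := @ulim_cvg x; apply.
exists ([set x' | (forall l, 0 < l < 1 -> `|u l x - u l x'| <= e / 4) /\
    `|ulim x - ulim x'| <= e / 4],
  [set l | `|ulim x - u l x| < e / 4 /\ 0 < l < 1]).
  split => /=; first exact: ulim_modulus.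
  by apply: filterI hx _; exact: near_ultra_small.
move=> [x' l] [/= [h1 h2] [h3 /h1]]; move: h2 h3.
rewrite !ler_norml !ltr_norml => /andP[? ?] /andP[? ?] /andP[? ?].
by apply/andP; split; lra.
Qed.

Lemma ulim_subsolution : critical_subsolution c c0 ulim.
Proof.
move=> x y; rewrite lerBlDr addrC.
have h : (1 - l * alpha x) * u l x + (c (x, y) + c0) @[l --> F] -->
    (1 - 0 * alpha x) * ulim x + (c (x, y) + c0).
  apply: cvgD; last exact: cvg_cst.
  apply: cvgM; last exact: ulim_cvg.
  apply: cvgB; first exact: cvg_cst.
  by apply: cvgM; [exact: cvg_ultra_id|exact: cvg_cst].
rewrite mul0r subr0 mul1r in h.
apply: (filter_le_cvg PF (@ulim_cvg y) h).
apply: filterS (near_ultra_small ltr01) => l l01.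
exact: (discounted_le (u_sol l01)).
Qed.

Lemma mather_integral mu : mather_measures c c0 mu ->
  [/\ bdd c, measurable_fun [set: borel (X * X)%type] c &
    \int[mu]_z c z = - c0].
Proof.
move=> [_ mc].
have bc := square_bdd X_compact c_cont.
have mcc := continuous_borel c_cont.
by split => //; move: mc; rewrite bdd_EFin_Rintegral// => -[].
Qed.

(** Integrating [u(y) <= (1 - l alpha(x)) u(x) + c(x, y) + c0] against a Mather
    measure kills the cost, and the two terms in [u] cancel by closedness. *)
Lemma discounted_mather_le0 l mu : 0 < l < 1 -> mather_measures c c0 mu ->
  \int[mu]_z (alpha z.1 * u l z.1) <= 0.
Proof.
move=> l01 mmu; have [bc mc cE] := mather_integral mmu.
have [cmu _] := mmu.
have ul_cont := discounted_continuous X_compact c_cont (u_sol l01).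
have /andP[l0 _] := l01.
have e12 := (closed_measureP X_compact mu).1 cmu _ ul_cont.
have au_cont : continuous (fun x => alpha x * u l x).
  by move=> x; apply: cvgM; [exact: alpha_cont|exact: ul_cont].
have lhsE : \int[mu]_z (l * (alpha z.1 * u l z.1) + u l z.2) =
    l * \int[mu]_z (alpha z.1 * u l z.1) + \int[mu]_z u l z.2.
  apply: Rintegral_linear; [exact: (comp_fst_measurable au_cont)|
    exact: (comp_fst_bdd X_compact au_cont)|
    exact: (comp_snd_measurable ul_cont)|
    exact: (comp_snd_bdd X_compact ul_cont)].
have c1E : \int[mu]_z (1 * c z + c0) = 0.
  rewrite (@Rintegral_linear _ _ _ mu 1 c (fun=> c0) mc bc
    (measurable_cst _) (bdd_cst _)).
  by rewrite cE Rintegral_cst_prob mul1r addNr.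
have rhsE : \int[mu]_z (1 * u l z.1 + (1 * c z + c0)) =
    1 * \int[mu]_z u l z.1 + \int[mu]_z (1 * c z + c0).
  apply: Rintegral_linear; [exact: (comp_fst_measurable ul_cont)|
    exact: (comp_fst_bdd X_compact ul_cont)| |].
  - apply: measurable_funD; last exact: measurable_cst.
    by apply: measurable_funM => //; exact: measurable_cst.
  - by apply: bddD => //; exact: bdd_cst.
have : \int[mu]_z (l * (alpha z.1 * u l z.1) + u l z.2) <=
    \int[mu]_z (1 * u l z.1 + (1 * c z + c0)).
  apply: le_Rintegral_bdd.
  - apply: measurable_funD; last exact: (comp_snd_measurable ul_cont).
    by apply: measurable_funM; [exact: measurable_cst|
      exact: (comp_fst_measurable au_cont)].
  - by apply: bddD; [exact: (comp_fst_bdd X_compact au_cont)|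
    exact: (comp_snd_bdd X_compact ul_cont)].
  - apply: measurable_funD.
      by apply: measurable_funM; [exact: measurable_cst|
      exact: (comp_fst_measurable ul_cont)].
    apply: measurable_funD; last exact: measurable_cst.
    by apply: measurable_funM => //; exact: measurable_cst.
  - apply: bddD; first exact: (comp_fst_bdd X_compact ul_cont).
    by apply: bddD => //; exact: bdd_cst.
  - by move=> [x y] /=; have := discounted_le (u_sol l01) y x; lra.
rewrite lhsE rhsE c1E e12 mul1r addr0 gerDr.
by rewrite pmulr_rle0.
Qed.

Lemma ulim_mather_le0 mu : mather_measures c c0 mu ->
  \int[mu]_z (alpha z.1 * ulim z.1) <= 0.
Proof.
move=> mmu; apply/ler_addgt0Pr => e e0; rewrite add0r.
have [l [h l01]] : exists l, (forall x, `|ulim x - u l x| < e) /\ 0 < l < 1.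
  exact: (filter_ex (filterI (ulim_uniform e0) (near_ultra_small ltr01))).
have ul_cont := discounted_continuous X_compact c_cont (u_sol l01).
have au_cont : continuous (fun x => alpha x * u l x).
  by move=> x; apply: cvgM; [exact: alpha_cont|exact: ul_cont].
have av_cont : continuous (fun x => alpha x * ulim x).
  by move=> x; apply: cvgM; [exact: alpha_cont|exact: ulim_continuous].
apply: (@le_trans _ _ (\int[mu]_z (1 * (alpha z.1 * u l z.1) + e))).
  apply: le_Rintegral_bdd; [exact: (comp_fst_measurable av_cont)|
    exact: (comp_fst_bdd X_compact av_cont)| | |].
  - apply: measurable_funD; last exact: measurable_cst.
    by apply: measurable_funM; [exact: measurable_cst|
      exact: (comp_fst_measurable au_cont)].
  - by apply: bddD; [exact: (comp_fst_bdd X_compact au_cont)|exact: bdd_cst].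
  - move=> z; have := h z.1; rewrite ltr_distl => /andP[_ h1].
    by have /andP[a0 a1] := alpha_bnd z.1; nra.
rewrite Rintegral_linear; [|exact: (comp_fst_measurable au_cont)|
  exact: (comp_fst_bdd X_compact au_cont)|exact: measurable_cst|exact: bdd_cst].
by rewrite Rintegral_cst_prob mul1r gerDr; exact: discounted_mather_le0.
Qed.

End UltraLimit.
End Limit.

(** * The formulas for the limit *)

Section Formula.
Context {R : realType} {X : pmetricType R}.
Hypothesis X_compact : compact [set: X].
Variables (c : X * X -> R) (c0 : R) (alpha : X -> R).
Hypothesis c_cont : continuous c.
Hypothesis c0_critical : is_critical_constant c c0.
Hypothesis alpha_cont : continuous alpha.
Hypothesis alpha_bnd : forall x, 0 <= alpha x < 1.
Hypothesis alpha_mather : forall mu, mather_measures c c0 mu ->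
  (0 < \int[marginal1 mu]_x (alpha x)%:E)%E.

Local Notation barrier_average x0 mu :=
  ((\int[mu]_z (alpha z.1 * barrier c c0 x0 z.1)) / \int[mu]_z alpha z.1).

Lemma alpha_barrier x0 :
  bdd (fun x => alpha x * barrier c c0 x0 x) /\
  measurable_fun [set: borel X] (fun x => alpha x * barrier c c0 x0 x).
Proof.
split.
  by apply: bddM; [exact: continuous_bdd|exact: barrier_bdd].
apply: measurable_funM; first exact: (continuous_borel alpha_cont).
exact: (barrier_measurable X_compact c_cont c0_critical x0).
Qed.

Lemma marginal_quotientE x0 mu : mather_measures c c0 mu ->
  ((\int[marginal1 mu]_x ((alpha x)%:E * peierls_barrier c c0 x x0))
     / \int[marginal1 mu]_x (alpha x)%:E)%E = (barrier_average x0 mu)%:E.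
Proof.
move=> mmu; have a0 := alpha_mather_gt0 X_compact alpha_cont alpha_mather mmu.
have [bab mab] := alpha_barrier x0.
have ba := continuous_bdd X_compact alpha_cont.
have ma := continuous_borel alpha_cont.
have -> : (\int[marginal1 mu]_x ((alpha x)%:E * peierls_barrier c c0 x x0) =
    \int[marginal1 mu]_x (alpha x * barrier c c0 x0 x)%:E)%E.
  congr (integral _ _ _); apply/funext => x.
  by have [-> _] := tail_cost_cvg_barrier X_compact c_cont c0_critical x0 x.
rewrite (marginal1_integral mu mab bab) (marginal1_integral mu ma ba).
by rewrite !first_marginal_integral// inver gt_eqF.
Qed.

(** Integrate [v x0 <= v x + h(x, x0)] against [alpha] times the marginal; the
    term in [v] is nonpositive.  Applied to the limit of the discounted
    solutions and to the members of [subsolutions_alpha] alike, this gives one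
    half of both formulas. *)
Lemma alpha_subsolution_le v mu x0 : subsolutions_alpha c c0 alpha v ->
  mather_measures c c0 mu -> v x0 <= barrier_average x0 mu.
Proof.
move=> [v_cont v_sub v_le0] mmu.
have a0 := alpha_mather_gt0 X_compact alpha_cont alpha_mather mmu.
have [bab mab] := alpha_barrier x0.
have ba := continuous_bdd X_compact alpha_cont.
have ma := continuous_borel alpha_cont.
have av_cont : continuous (fun x => alpha x * v x).
  by move=> x; apply: cvgM; [exact: alpha_cont|exact: v_cont].
have bav := continuous_bdd X_compact av_cont.
have mav := continuous_borel av_cont.
have av0 : \int[mu]_z (alpha z.1 * v z.1) <= 0.
  have := v_le0 mu mmu; rewrite marginal1_integral// lee_fin.
  by rewrite first_marginal_integral.
rewrite ler_pdivlMr//.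
rewrite -(first_marginal_integral mu mab bab).
rewrite -(first_marginal_integral mu ma ba).
rewrite -(first_marginal_integral mu mav bav) in av0.
set m := first_marginal mu in av0 *.
have E1 : \int[m]_x (v x0 * alpha x + 0) = v x0 * \int[m]_x alpha x.
  rewrite (@Rintegral_linear _ _ _ m (v x0) alpha (fun=> 0) ma ba
    (measurable_cst _) (bdd_cst _)).
  by rewrite Rintegral_cst_prob addr0.
have E2 : \int[m]_x (1 * (alpha x * v x) + alpha x * barrier c c0 x0 x) =
    1 * \int[m]_x (alpha x * v x) + \int[m]_x (alpha x * barrier c c0 x0 x).
  exact: Rintegral_linear.
rewrite -E1; apply: (@le_trans _ _
    (\int[m]_x (1 * (alpha x * v x) + alpha x * barrier c c0 x0 x))); last first.
  by rewrite E2 mul1r gerDr.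
apply: le_Rintegral_bdd.
- apply: measurable_funD; last exact: measurable_cst.
  by apply: measurable_funM => //; exact: measurable_cst.
- by apply: bddD => //; exact: bdd_cst.
- apply: measurable_funD => //.
  by apply: (@measurable_funM _ (borel X) R setT (fun=> 1)).
- exact: bddD.
- move=> x; have := barrier_ge X_compact c_cont c0_critical x0 x v_sub.
  by have /andP[? ?] := alpha_bnd x; nra.
Qed.

End Formula.

Theorem theorem3p4p12 (R : realType) (X : pmetricType R)
    (X_compact : compact [set: X])
    (c : X * X -> R) (c_cont : continuous c)
    (c0 : R) (c0_critical : is_critical_constant c c0)
    (alpha : X -> R) (alpha_cont : continuous alpha)
    (alpha_bnd : forall x, 0 <= alpha x < 1)
    (alpha_mather : forall mu, mather_measures c c0 mu ->
       (0 < \int[marginal1 mu]_x (alpha x)%:E)%E)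
    (u : R -> X -> R)
    (u_sol : forall l, 0 < l < 1 -> discounted_solution c c0 alpha l (u l)) :
  exists u0 : X -> R,
    [/\ {uniform, u l @[l --> 0^'+] --> u0},
      forall x0, is_max [set v x0 | v in subsolutions_alpha c c0 alpha] (u0 x0)
    & forall x0, is_min
        [set ((\int[marginal1 mu]_x ((alpha x)%:E * peierls_barrier c c0 x x0))
              / \int[marginal1 mu]_x (alpha x)%:E)%E
          | mu in mather_measures c c0] (u0 x0)%:E].
Proof.
have limP (F : set_system R) : UltraFilter F -> (0 : R)^'+ `<=` F ->
    subsolutions_alpha c c0 alpha (ulim u F) /\
    forall x0, is_min
        [set ((\int[marginal1 mu]_x ((alpha x)%:E * peierls_barrier c c0 x x0))
              / \int[marginal1 mu]_x (alpha x)%:E)%E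
          | mu in mather_measures c c0] (ulim u F x0)%:E.
  move=> UF F0.
  have Fsub : subsolutions_alpha c c0 alpha (ulim u F).
    have u_cont : continuous (ulim u F) by
      exact: (ulim_continuous X_compact c_cont c0_critical alpha_cont alpha_bnd
        alpha_mather u_sol F0).
    split => //; first
      exact: (ulim_subsolution X_compact c_cont c0_critical alpha_cont alpha_bnd
        alpha_mather u_sol F0).
    move=> mu mmu; have au_cont : continuous (fun x => alpha x * ulim u F x).
      by move=> x; apply: cvgM; [exact: alpha_cont|exact: u_cont].
    have mau := continuous_borel au_cont.
    have bau := continuous_bdd X_compact au_cont.
    rewrite marginal1_integral// first_marginal_integral// lee_fin.
    exact: (ulim_mather_le0 X_compact c_cont c0_critical alpha_cont alpha_bnd
      alpha_mather u_sol F0).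
  split => // x0; split; last first.
    move=> _ [mu mmu <-]; rewrite marginal_quotientE// lee_fin.
    exact: alpha_subsolution_le.
  have [mu mmu mu_le] := selected_measure X_compact c_cont c0_critical
    alpha_cont alpha_bnd alpha_mather u_sol F0 x0.
  exists mu => //; rewrite marginal_quotientE//; congr EFin.
  have a0 := alpha_mather_gt0 X_compact alpha_cont alpha_mather mmu.
  by apply/eqP; rewrite eq_le ler_pdivrMr// mu_le alpha_subsolution_le.
have [F [UF F0]] := @ultraFilterLemma R (0 : R)^'+ _.
exists (ulim u F); have [Fsub Fmin] := limP F UF F0.
(* The minimum formula determines the limit, whatever the ultrafilter *)
have same (G : set_system R) : UltraFilter G -> (0 : R)^'+ `<=` G ->
    ulim u G = ulim u F.
  move=> UG G0; have [_ Gmin] := limP G UG G0; apply/funext => x.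
  have [SG lbG] := Gmin x; have [SF lbF] := Fmin x.
  by apply/eqP; rewrite eq_le -!lee_fin lbG// lbF.
split => //; last first.
  move=> x0; split; first by exists (ulim u F).
  move=> _ [v v_sub <-]; rewrite -lee_fin; have [[mu mmu <-] _] := Fmin x0.
  by rewrite marginal_quotientE// lee_fin; exact: alpha_subsolution_le.
(* Otherwise some ultrafilter finer than 0^'+ would avoid the closeness set *)
have unif e : 0 < e -> \forall l \near 0^'+, forall x, `|ulim u F x - u l x| < e.
  move=> e0; pose B := [set l | forall x, `|ulim u F x - u l x| < e].
  suff : ((0 : R)^'+) B by [].
  apply: contrapT => nB.
  have PG : ProperFilter (within (~` B) (0 : R)^'+).
    split; last exact: within_filter.
    move=> h; apply: nB; apply: (@filterS _ (0 : R)^'+ _ _ B _ h) => l nBl.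
    by apply: contrapT => /nBl.
  have [G [UG GG]] := ultraFilterLemma PG.
  have G0 : (0 : R)^'+ `<=` G.
    move=> A A0; apply: GG; apply: (@filterS _ (0 : R)^'+ _ A _ _ A0) => l Al _.
    exact: Al.
  have GB : \forall l \near G, forall x, `|ulim u F x - u l x| < e.
    rewrite -(same G UG G0).
    exact: (ulim_uniform X_compact c_cont c0_critical alpha_cont alpha_bnd
      alpha_mather u_sol G0 e0).
  have GnB : G (~` B) by apply: GG; exact: withinT.
  by have [l [/= nBl]] := filter_ex (filterI GnB GB).
move=> A /uniform_nbhs[E [/= entE EA]].
apply: (filterS (P := fun l =>
    [set h : X -> R | forall y, [set: X] y -> E (ulim u F y, h y)] (u l))).
  by move=> l; exact: EA.
move: entE; rewrite -entourage_ballE => -[e /= e0 eE].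
by apply: filterS (unif e e0) => l h y _; apply: eE => /=; exact: h.
Qed.
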